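(* Let $\varepsilon>0$ be fixed but arbitrary. Assume that $\mathrm{Re}\,\lambda\ge-\frac12+\varepsilon$ and $|\lambda|$ is sufficiently large. Then the resolvent $R_L(\lambda)$ exists and it is uniformly bounded as $|\lambda|\to\infty$; that is, there exist constants $r>0$ and $C>0$ (depending on $\varepsilon$) such that every $\lambda\in\mathbb{C}$ with $\mathrm{Re}\,\lambda\ge-\frac12+\varepsilon$ and $|\lambda|\ge r$ belongs to the resolvent set $\rho(L)$ and satisfies $\|R_L(\lambda)\|\le C$. In particular, the operator $L$ does not have spectrum far away from the real axis in the right half-plane $\{\lambda\in\mathbb{C}:\mathrm{Re}\,\lambda\ge-\frac12+\varepsilon\}$.
   Context: All functions are complex-valued. Let $\tilde H_1=\{u\in C^2[0,1]:u(0)=u'(0)=0\}$ and $\tilde H_2=\{u\in C^1[0,1]:u(0)=0\}$ with inner products $(u|v)_1=\int_0^1 u'(\rho)\overline{v'(\rho)}\,\rho^{-2}d\rho$, $(u|v)_2=\int_0^1 u'(\rho)\overline{v'(\rho)}\,d\rho$ and induced norms $\|\cdot\|_j$. Let $H_j$ be the completion of $\tilde H_j$, $\tilde{\mathcal{H}}=\tilde H_1\times\tilde H_2$, and let $\mathcal{H}=H_1\times H_2$ be the Hilbert space with inner product $(\mathbf{u}|\mathbf{v})=(u_1|v_1)_1+(u_2|v_2)_2$ and norm $\|\cdot\|$. Define $\tilde L_0:\mathcal{D}(\tilde L_0)\subset\mathcal{H}\to\mathcal{H}$ by $\mathcal{D}(\tilde L_0)=\{u\in C^3[0,1]:u(0)=u'(0)=u''(0)=0\}\times\{u\in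 C^3[0,1]:u(0)=0\}$ and $$\tilde L_0\mathbf{u}(\rho)=\begin{pmatrix}-\rho u_1'(\rho)+u_1(\rho)+\rho u_2'(\rho)-u_2(\rho)\\ \frac1\rho u_1'(\rho)-\rho u_2'(\rho)\end{pmatrix}.$$ $\tilde L_0$ is closable; $L_0$ denotes its closure. Let $L':\mathcal{H}\to\mathcal{H}$ be the bounded operator extending $$L'\mathbf{u}(\rho)=\begin{pmatrix}-V_1(\rho)\int_0^\rho\rho'u_2(\rho')d\rho'\\0\end{pmatrix},\qquad V_1(\rho)=-\frac{16}{(1+\rho^2)^2},$$ from $\tilde{\mathcal{H}}$. Put $L=L_0+L'$, $\mathcal{D}(L)=\mathcal{D}(L_0)$. For $\lambda$ in the resolvent set $\rho(L)$, $R_L(\lambda)=(\lambda-L)^{-1}$. *)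

(* Defs.v *)
From Stdlib Require Import Reals Lra.
From Coquelicot Require Import Coquelicot.

Open Scope R_scope.

(* A function on [0,1] is represented by a function [R -> C] whose values
    outside [0,1] are irrelevant: derivatives are taken relatively to [0,1]
    (hence are one-sided at 0 and 1) and everything below depends on the values
    on [0,1] only. *)

Definition I01 (x : R) : Prop := 0 <= x <= 1.

Definition is_deriv01 (u : R -> C) (x : R) (l : C) : Prop :=
  filterdiff (K := R_AbsRing) (U := R_NormedModule) (V := C_R_NormedModule)
    u (within I01 (locally x)) (fun h : R => scal h (l : C_R_NormedModule)).

(* The derivative as a total function; meaningful at the points of [0,1] where
   [u] is differentiable. *)
Definition D01 (u : R -> C) (x : R) : C :=
  iota (T := C_R_CompleteNormedModule) (is_deriv01 u x).

Fixpoint Ck01 (k : nat) (u : R -> C) : Prop :=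
  match k with
  | O => continuous_on (T := R_UniformSpace) (U := C_UniformSpace) I01 u
  | S k' => (forall x, I01 x -> exists l, is_deriv01 u x l) /\ Ck01 k' (D01 u)
  end.

Definition CInt (f : R -> C) (a b : R) : C :=
  RInt (V := C_R_CompleteNormedModule) f a b.

Definition tH1 (u : R -> C) : Prop :=
  Ck01 2 u /\ u 0 = RtoC 0 /\ D01 u 0 = RtoC 0.

Definition tH2 (u : R -> C) : Prop :=
  Ck01 1 u /\ u 0 = RtoC 0.

(* On [tH1] the integrand extends continuously to 0, since u'(0) = v'(0) = 0
   and u, v are C^2; hence a proper Riemann integral is enough. *)
Definition ip1 (u v : R -> C) : C :=
  CInt (fun r => D01 u r * Cconj (D01 v r) * RtoC (/ r ^ 2))%C 0 1.

Definition ip2 (u v : R -> C) : C :=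
  CInt (fun r => D01 u r * Cconj (D01 v r))%C 0 1.

Record Hilbert := MkHilbert {
  hsort :> CompleteNormedModule C_AbsRing;
  hdot : hsort -> hsort -> C;
  hdot_plus : forall x y z, hdot (plus x y) z = (hdot x z + hdot y z)%C;
  hdot_scal : forall (c : C) x y, hdot (scal c x) y = (c * hdot x y)%C;
  hdot_conj : forall x y, hdot y x = Cconj (hdot x y);
  hdot_norm : forall x, hdot x x = RtoC (norm x ^ 2)
}.

Arguments hdot {h} _ _.

Section ProductCompleteness.

Context {K : AbsRing} (U V : CompleteNormedModule K).

Definition prod_lim (F : (U * V -> Prop) -> Prop) : U * V :=
  (lim (filtermap fst F), lim (filtermap snd F)).

Lemma prod_complete_ax1 (F : (U * V -> Prop) -> Prop) :
  ProperFilter F -> cauchy (T := prod_UniformSpace U V) F ->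
  forall eps : posreal,
    F (ball (M := prod_UniformSpace U V) (prod_lim F) eps).
Proof.
intros PF H eps.
assert (H1 : cauchy (filtermap (fst : U * V -> U) F)).
{ intros e; destruct (H e) as [[x y] Hxy]; exists x; unfold filtermap.
  eapply filter_imp; [|exact Hxy]; intros z [Hz _]; exact Hz. }
assert (H2 : cauchy (filtermap (snd : U * V -> V) F)).
{ intros e; destruct (H e) as [[x y] Hxy]; exists y; unfold filtermap.
  eapply filter_imp; [|exact Hxy]; intros z [_ Hz]; exact Hz. }
pose proof (complete_cauchy _ (filtermap_proper_filter _ _ _ _ PF) H1 eps) as E1.
pose proof (complete_cauchy _ (filtermap_proper_filter _ _ _ _ PF) H2 eps) as E2.
unfold filtermap in E1, E2.
generalize (filter_and _ _ E1 E2); apply filter_imp.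
intros z [A B]; split; [exact A | exact B].
Qed.

Lemma prod_complete_ax2 (F1 F2 : (U * V -> Prop) -> Prop) :
  filter_le F1 F2 -> filter_le F2 F1 ->
  close (M := prod_UniformSpace U V) (prod_lim F1) (prod_lim F2).
Proof.
intros H12 H21 eps; split.
- refine (close_lim (filtermap fst F1) (filtermap fst F2) _ _ eps);
    intros P; unfold filtermap; [apply H12 | apply H21].
- refine (close_lim (filtermap snd F1) (filtermap snd F2) _ _ eps);
    intros P; unfold filtermap; [apply H12 | apply H21].
Qed.

Definition prod_CompleteSpace_mixin :=
  CompleteSpace.Mixin (prod_UniformSpace U V) prod_lim
    prod_complete_ax1 prod_complete_ax2.

Definition prod_CompleteNormedModule : CompleteNormedModule K :=
  CompleteNormedModule.Pack K (U * V)
    (CompleteNormedModule.Class K (U * V)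
      (NormedModule.class K (prod_NormedModule K U V))
      prod_CompleteSpace_mixin) (U * V).

End ProductCompleteness.

Section ProductHilbert.

Context (H1 H2 : Hilbert).

Definition prod_hdot (x y : prod_CompleteNormedModule H1 H2) : C :=
  (hdot (fst x) (fst y) + hdot (snd x) (snd y))%C.

Lemma prod_hdot_plus (x y z : prod_CompleteNormedModule H1 H2) :
  prod_hdot (plus x y) z = (prod_hdot x z + prod_hdot y z)%C.
Proof.
unfold prod_hdot; destruct x as [x1 x2], y as [y1 y2]; simpl.
rewrite !hdot_plus; ring.
Qed.

Lemma prod_hdot_scal (c : C) (x y : prod_CompleteNormedModule H1 H2) :
  prod_hdot (scal c x) y = (c * prod_hdot x y)%C.
Proof.
unfold prod_hdot; destruct x as [x1 x2]; simpl.
rewrite !hdot_scal; ring.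
Qed.

Lemma prod_hdot_conj (x y : prod_CompleteNormedModule H1 H2) :
  prod_hdot y x = Cconj (prod_hdot x y).
Proof.
unfold prod_hdot; rewrite (hdot_conj _ (fst x)), (hdot_conj _ (snd x)).
unfold Cconj, Cplus; simpl; f_equal; ring.
Qed.

Lemma prod_hdot_norm (x : prod_CompleteNormedModule H1 H2) :
  prod_hdot x x = RtoC (norm x ^ 2).
Proof.
unfold prod_hdot; rewrite !hdot_norm, <- RtoC_plus; f_equal.
change (norm x) with (sqrt (norm (fst x) ^ 2 + norm (snd x) ^ 2)).
rewrite pow2_sqrt; [reflexivity|].
apply Rplus_le_le_0_compat; apply pow2_ge_0.
Qed.

Definition prod_Hilbert : Hilbert :=
  MkHilbert (prod_CompleteNormedModule H1 H2) prod_hdot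
    prod_hdot_plus prod_hdot_scal prod_hdot_conj prod_hdot_norm.

End ProductHilbert.

(* [H], with the embedding [j], is the completion of the space of functions [S]
   with respect to the inner product [ip]; this determines [H] and [j] up to a
   unique isometric isomorphism.  The values of [j] outside [S] are
   irrelevant. *)
Record is_completion (S : (R -> C) -> Prop) (ip : (R -> C) -> (R -> C) -> C)
    (H : Hilbert) (j : (R -> C) -> H) : Prop := {
  completion_plus : forall u v, S u -> S v ->
    j (fun r => u r + v r)%C = plus (j u) (j v);
  completion_scal : forall (c : C) u, S u ->
    j (fun r => c * u r)%C = scal c (j u);
  completion_dot : forall u v, S u -> S v -> hdot (j u) (j v) = ip u v;
  completion_dense : forall (x : H) (eps : posreal),
    exists u, S u /\ norm (minus (j u) x) < eps
}.

(* An unbounded operator is represented by its graph. *)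
Definition is_operator {H : Hilbert} (A : H -> H -> Prop) : Prop :=
  forall u v w, A u v -> A u w -> v = w.

(* The graph of the closure of a closable operator is the closure of its
   graph. *)
Definition op_closure {H : Hilbert} (A : H -> H -> Prop) (u v : H) : Prop :=
  forall eps : posreal, exists u' v',
    A u' v' /\ norm (minus u' u) < eps /\ norm (minus v' v) < eps.

Definition op_plus {H : Hilbert} (A : H -> H -> Prop) (B : H -> H) (u v : H)
  : Prop := exists w, A u w /\ v = plus w (B u).

(* [T] is a bounded two-sided inverse of [l - A : dom A -> H]; recall that
   Coquelicot's [is_linear] includes boundedness. *)
Definition is_resolvent {H : Hilbert} (A : H -> H -> Prop) (l : C) (T : H -> H)
  : Prop :=
  is_linear T /\
  (forall f, exists v, A (T f) v /\ minus (scal l (T f)) v = f) /\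
  (forall u v, A u v -> T (minus (scal l u) v) = u).

Definition resolvent_set {H : Hilbert} (A : H -> H -> Prop) (l : C) : Prop :=
  is_operator A /\ exists T, is_resolvent A l T.

Definition spectrum {H : Hilbert} (A : H -> H -> Prop) (l : C) : Prop :=
  ~ resolvent_set A l.

Definition op_norm {H : Hilbert} (T : H -> H) : Rbar :=
  Lub_Rbar (fun r => exists f, norm f <= 1 /\ r = norm (T f)).

Definition dom_tL0 (u1 u2 : R -> C) : Prop :=
  (Ck01 3 u1 /\ u1 0 = RtoC 0 /\ D01 u1 0 = RtoC 0 /\ D01 (D01 u1) 0 = RtoC 0) /\
  (Ck01 3 u2 /\ u2 0 = RtoC 0).

Definition tL0_1 (u1 u2 : R -> C) (r : R) : C :=
  (- RtoC r * D01 u1 r + u1 r + RtoC r * D01 u2 r - u2 r)%C.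

(* On [dom_tL0] the continuous extension to r = 0 has value 0, which is also
   the value given by this formula since u1'(0) = 0. *)
Definition tL0_2 (u1 u2 : R -> C) (r : R) : C :=
  (RtoC (/ r) * D01 u1 r - RtoC r * D01 u2 r)%C.

Definition V1 (r : R) : R := - (16 / (1 + r ^ 2) ^ 2).

Definition tL'_1 (u2 : R -> C) (r : R) : C :=
  (- RtoC (V1 r) * CInt (fun s => RtoC s * u2 s) 0 r)%C.

Section Operators.

Context {H1 H2 : Hilbert} (j1 : (R -> C) -> H1) (j2 : (R -> C) -> H2).

Definition tL0 (u v : prod_Hilbert H1 H2) : Prop :=
  exists u1 u2, dom_tL0 u1 u2 /\
    u = (j1 u1, j2 u2) /\ v = (j1 (tL0_1 u1 u2), j2 (tL0_2 u1 u2)).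

Definition L0 : prod_Hilbert H1 H2 -> prod_Hilbert H1 H2 -> Prop :=
  op_closure tL0.

(* Such an [L'] is unique, since the image of tH1 x tH2 is dense. *)
Definition is_L' (L' : prod_Hilbert H1 H2 -> prod_Hilbert H1 H2) : Prop :=
  is_linear L' /\
  forall u1 u2, tH1 u1 -> tH2 u2 -> L' (j1 u1, j2 u2) = (j1 (tL'_1 u2), zero).

Definition L (L' : prod_Hilbert H1 H2 -> prod_Hilbert H1 H2) :
  prod_Hilbert H1 H2 -> prod_Hilbert H1 H2 -> Prop :=
  op_plus L0 L'.

End Operators.

(* Main.v *)
Require Import Defs.
From Stdlib Require Import Reals Lra Lia.
From Coquelicot Require Import Coquelicot.
Open Scope R_scope.

(** [H1] and [H2] are given only up to isometry, so every estimate is proved for functions in the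
    core, with Riemann integrals of continuous representatives, and reaches the closure by a limit
    argument in an abstract Hilbert space. No resolvent of [L0] is built: approximate solutions of
    the unperturbed equation are iterated inside the core, and completeness is used once, for the
    sum with [L'].

    The number -1/2 comes from the factor rho in L0: the terms -(rho a)' a and -(rho b)' b each lose
    half a square. The condition a(0) = 0, which is u1''(0) = 0, removes the boundary term at 0.
    Dense range needs only Re l > -1.

    The two Euler equations behave differently. The one for p degenerates at rho = 1, an endpoint of
    the interval; its homogeneous solutions are singular there, so regularity already fixes p and no
    constant is left. The one for q degenerates at rho = -1, outside the interval; its homogeneous
    solution is smooth on [0,1] and supplies the one constant needed for a(0) = 0. *)

(* Write a = u1' / rho and b = u2'.  Then the norm of u is the L^2 norm of
   (a, b), L0 acts as (a, b) |-> (b' - (rho a)', a' - (rho b)'), and the core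
   consists of smooth pairs with a(0) = 0.  Integrating by parts,
   Re (L0 u | u) <= - |u|^2 / 2; and p = a + b, q = a - b decouple l - L0 into
   two Euler equations that are solved explicitly for polynomial data, so
   l - L0 has dense range and is bounded below by Re l + 1/2.

   For u in the core and phi = l u - L0 u, the second component reads
   l u2 = phi2 + a - rho b.  Hence |l| |u2|_{L^2} <= C (|phi| + |u|), and since
   L' u is controlled by |u2|_{L^2}, it is smaller than |phi| / 2 once |l| is
   large: adding L' is then a small relative perturbation. *)

(** * Hilbert space geometry *)

(* Coquelicot reaches the operations of a complete normed module along several
   convertible paths; fixing one makes rewriting work. *)
Notation hplus := (@plus (CompleteNormedModule.AbelianMonoid C_AbsRing (hsort _))).
Notation hminus := (@minus (CompleteNormedModule.AbelianGroup C_AbsRing (hsort _))).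
Notation hopp := (@opp (CompleteNormedModule.AbelianGroup C_AbsRing (hsort _))).
Notation hzero := (@zero (CompleteNormedModule.AbelianMonoid C_AbsRing (hsort _))).
Notation hscal :=
  (@scal C_Ring (CompleteNormedModule.ModuleSpace C_AbsRing (hsort _))).

Section HilbertFacts.

Context {H : Hilbert}.
Implicit Types x y z u v w : H.

Lemma hdot_opp x y : hdot (hopp x) y = (- hdot x y)%C.
Proof.
replace (hopp x) with (hscal (opp one : C_Ring) x) by exact (scal_opp_one x).
rewrite hdot_scal.
change (opp one : C_AbsRing) with (Copp (RtoC 1)); ring.
Qed.

Lemma hdot_minus x y z : hdot (hminus x y) z = (hdot x z - hdot y z)%C.
Proof. unfold hminus; rewrite hdot_plus, hdot_opp; reflexivity. Qed.

Lemma hdot_zero y : hdot hzero y = RtoC 0.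
Proof.
replace hzero with (hscal (zero : C_Ring) y) by exact (scal_zero_l y).
rewrite hdot_scal.
change (zero : C_AbsRing) with (RtoC 0); ring.
Qed.

Lemma hdot_ext x y : (forall z, hdot x z = hdot y z) -> x = y.
Proof.
intros E.
assert (N : norm (hminus x y) = 0).
{ assert (Q : RtoC (norm (hminus x y) ^ 2) = RtoC 0).
  { rewrite <- hdot_norm, hdot_minus, E; ring. }
  apply RtoC_inj in Q; nra. }
apply (plus_reg_r (hopp y)); transitivity (hzero : H).
- exact (norm_eq_zero _ N).
- symmetry; exact (plus_opp_r y).
Qed.

End HilbertFacts.

(* Vector identities become ring identities in [C] after pairing with an
   arbitrary vector. *)
Ltac hring :=
  apply hdot_ext; intros;
  repeat rewrite ?hdot_plus, ?hdot_minus, ?hdot_opp, ?hdot_scal, ?hdot_zero;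
  try change (one : C_AbsRing) with (RtoC 1); ring.

Definition rdot {H : Hilbert} (x y : H) : R := Re (hdot x y).

Section RealInnerProduct.

Context {H : Hilbert}.
Implicit Types x y z u v w : H.

Lemma rdot_sym x y : rdot x y = rdot y x.
Proof. unfold rdot; rewrite (hdot_conj _ x y); reflexivity. Qed.

Lemma rdot_plus x y z : rdot (hplus x y) z = rdot x z + rdot y z.
Proof. unfold rdot; rewrite hdot_plus; reflexivity. Qed.

Lemma rdot_minus x y z : rdot (hminus x y) z = rdot x z - rdot y z.
Proof. unfold rdot; rewrite hdot_minus; reflexivity. Qed.

Lemma rdot_scal (t : R) x y : rdot (hscal (RtoC t) x) y = t * rdot x y.
Proof. unfold rdot; rewrite hdot_scal; unfold Re, RtoC; simpl; ring. Qed.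

Lemma rdot_norm x : rdot x x = norm x ^ 2.
Proof. unfold rdot; rewrite hdot_norm; reflexivity. Qed.

Lemma rdot_scal_self (c : C) x : rdot (hscal c x) x = Re c * norm x ^ 2.
Proof.
unfold rdot; rewrite hdot_scal, hdot_norm; unfold Re, RtoC; simpl; ring.
Qed.

Lemma norm_minus_sqr x y :
  norm (hminus x y) ^ 2 = norm x ^ 2 - 2 * rdot x y + norm y ^ 2.
Proof.
rewrite <- !rdot_norm, rdot_minus, !(rdot_sym _ (hminus x y)), !rdot_minus.
rewrite (rdot_sym y x); ring.
Qed.

Lemma norm_scal_real (t : R) x : norm (hscal (RtoC t) x) ^ 2 = t ^ 2 * norm x ^ 2.
Proof.
rewrite <- !rdot_norm, rdot_scal, rdot_sym, rdot_scal; ring.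
Qed.

Lemma norm_scal_C (c : C) x : norm (hscal c x) = Cmod c * norm x.
Proof.
assert (E : norm (hscal c x) ^ 2 = (Cmod c * norm x) ^ 2).
{ apply RtoC_inj; rewrite Rpow_mult_distr, RtoC_mult, Cmod2_conj, <- !hdot_norm.
  rewrite hdot_scal, (hdot_conj _ (hscal c x) x), hdot_scal, hdot_norm.
  destruct c; apply injective_projections; simpl; ring. }
apply Rsqr_inj; [apply norm_ge_0 | | unfold Rsqr; simpl in E; lra].
apply Rmult_le_pos; [apply Cmod_ge_0 | apply norm_ge_0].
Qed.

Lemma rdot_norm_zero x y : norm x = 0 -> rdot x y = 0.
Proof.
intros Z; apply norm_eq_zero in Z; rewrite Z.
change (Re (hdot hzero y) = 0); rewrite hdot_zero; reflexivity.
Qed.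

(** Cauchy-Schwarz: expand the square of the norm of |y| x - |x| y and divide by 2 |x| |y|, which is
    why zero norms are treated apart. *)
Lemma rdot_le x y : rdot x y <= norm x * norm y.
Proof.
pose proof (norm_ge_0 x) as Nx; pose proof (norm_ge_0 y) as Ny.
destruct (Rle_lt_or_eq_dec _ _ Nx) as [Px|Zx].
- destruct (Rle_lt_or_eq_dec _ _ Ny) as [Py|Zy].
  + pose proof (pow2_ge_0
      (norm (hminus (hscal (RtoC (norm y)) x) (hscal (RtoC (norm x)) y)))) as P.
    rewrite norm_minus_sqr, !norm_scal_real, rdot_scal, rdot_sym, rdot_scal,
      (rdot_sym y x) in P.
    assert (0 < norm x * norm y) by (apply Rmult_lt_0_compat; lra).
    nra.
  + rewrite rdot_sym, (rdot_norm_zero _ _ (eq_sym Zy)), <- Zy; lra.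
- rewrite (rdot_norm_zero _ _ (eq_sym Zx)), <- Zx; lra.
Qed.

Lemma norm_plus_le x y : norm (hplus x y) <= norm x + norm y.
Proof. exact (norm_triangle x y). Qed.

Lemma norm_minus_swap x y : norm (hminus x y) = norm (hminus y x).
Proof.
transitivity (norm (hopp (hminus y x))); [|exact (norm_opp _)].
f_equal; hring.
Qed.

Lemma norm_minus_ge x y : norm x - norm y <= norm (hminus x y).
Proof.
assert (E : x = hplus (hminus x y) y) by hring.
pose proof (norm_plus_le (hminus x y) y) as N; rewrite <- E in N; lra.
Qed.

Lemma norm_minus_trans x y z :
  norm (hminus x z) <= norm (hminus x y) + norm (hminus y z).
Proof.
assert (E : hminus x z = hplus (hminus x y) (hminus y z)) by hring.
rewrite E; apply norm_plus_le.
Qed.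

Lemma norm_minus_zero x y : norm (hminus x y) = 0 -> x = y.
Proof.
intros N; apply (plus_reg_r (hopp y)); transitivity (hzero : H).
- exact (norm_eq_zero _ N).
- symmetry; exact (plus_opp_r y).
Qed.

End RealInnerProduct.

(** * Bounded perturbations of dissipative operators *)

Section Resolvent.

Context {H : Hilbert} (A : H -> H -> Prop) (B : H -> H).

Hypothesis A_plus : forall u v u' v',
  A u v -> A u' v' -> A (hplus u u') (hplus v v').
Hypothesis A_scal : forall (c : C) u v, A u v -> A (hscal c u) (hscal c v).
Hypothesis A_dense : forall (x : H) (d : posreal),
  exists u v, A u v /\ norm (hminus u x) < d.
Hypothesis A_dissipative : forall u v,
  A u v -> rdot v u <= - (1 / 2) * norm u ^ 2.

(** The real part of (l u - v | u) is at least (Re l + 1/2) |u|^2; Cauchy-Schwarz then allows one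
    factor |u| to be cancelled. *)
Lemma dissipative_lower_bound (l : C) (u v : H) : A u v ->
  (Re l + 1 / 2) * norm u <= norm (hminus (hscal l u) v).
Proof.
intros Auv; pose proof (A_dissipative _ _ Auv) as D.
pose proof (rdot_le (hminus (hscal l u) v) u) as CS.
rewrite rdot_minus, rdot_scal_self in CS.
destruct (Rle_lt_or_eq_dec _ _ (norm_ge_0 u)) as [P|Z].
- apply Rmult_le_reg_r with (norm u); [exact P | nra].
- rewrite <- Z, Rmult_0_r; apply norm_ge_0.
Qed.

(* If (0,v) lies in the closure, then letting s tend to 0 in the dissipativity
   inequality along (s u, v + s w) gives Re (v|u) <= 0 on the dense domain. *)
Lemma dissipative_closable : is_operator (op_closure A).
Proof.
intros u v1 v2 C1 C2.
set (v := hminus v1 v2).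
(* Subtracting approximants of the two pairs (u, v1) and (u, v2) gives elements of the graph close
   to (0, v1 - v2). *)
assert (L0v : forall d : posreal, exists x y, A x y /\ norm x < d /\ norm (hminus y v) < d).
{ intros d; assert (Hd : 0 < d / 2) by (pose proof (cond_pos d); lra).
  destruct (C1 (mkposreal _ Hd)) as (x1 & y1 & A1 & X1 & Y1); simpl in *.
  destruct (C2 (mkposreal _ Hd)) as (x2 & y2 & A2 & X2 & Y2); simpl in *.
  exists (hplus x1 (hscal (RtoC (Ropp 1)) x2)), (hplus y1 (hscal (RtoC (Ropp 1)) y2)).
  split; [|split].
  - apply A_plus; [exact A1 | apply A_scal, A2].
  - replace (hplus x1 (hscal (RtoC (Ropp 1)) x2)) with (hminus (hminus x1 u) (hminus x2 u))
      by (rewrite RtoC_opp; hring).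
    pose proof (norm_minus_trans (hminus x1 u) hzero (hminus x2 u)) as T.
    replace (hminus (hminus x1 u) hzero) with (hminus x1 u) in T by hring.
    replace (hminus hzero (hminus x2 u)) with (hminus u x2) in T by hring.
    rewrite (norm_minus_swap u) in T; lra.
  - replace (hminus (hplus y1 (hscal (RtoC (Ropp 1)) y2)) v)
      with (hplus (hminus y1 v1) (hminus v2 y2)) by (unfold v; rewrite RtoC_opp; hring).
    pose proof (norm_plus_le (hminus y1 v1) (hminus v2 y2)).
    rewrite (norm_minus_swap v2) in H0; lra. }
assert (Neg : forall u w, A u w -> rdot v u <= 0).
{ intros z w Azw.
  pose proof (norm_ge_0 z) as Nz; pose proof (norm_ge_0 w) as Nw.
  pose proof (norm_ge_0 v) as Nv.
  assert (K : forall s, 0 < s < 1 -> rdot v z <= s * norm w * norm z + s).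
  { intros s Hs.
    (* The pair (x, y) is taken within d = s^2 / (2 M) of (0, v). All terms containing x or y - v
       then add up to at most d M = s^2 / 2, so an error of order s survives the division by s. *)
    set (M := 1 + norm z + norm v + norm w + 1).
    assert (Hd : 0 < s ^ 2 / (2 * M)) by (apply Rdiv_lt_0_compat; unfold M; nra).
    destruct (L0v (mkposreal _ Hd)) as (x & y & Axy & X & Y); cbn [pos] in X, Y.
    set (d := s ^ 2 / (2 * M)) in *.
    assert (dM : d * M = s ^ 2 / 2) by (unfold d; field; unfold M; nra).
    assert (d1 : d <= 1).
    { unfold M in dM. nra. }
    pose proof (A_dissipative _ _ (A_plus _ _ _ _ Axy (A_scal (RtoC s) _ _ Azw))) as D.
    assert (D0 : rdot (hplus y (hscal (RtoC s) w)) (hplus x (hscal (RtoC s) z)) <= 0).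
    { pose proof (pow2_ge_0 (norm (hplus x (hscal (RtoC s) z)))); nra. }
    clear D.
    rewrite rdot_plus, !(rdot_sym _ (hplus x _)), !rdot_plus, !rdot_scal in D0.
    rewrite !(rdot_sym _ (hscal (RtoC s) w)), !rdot_scal in D0.
    replace y with (hplus v (hminus y v)) in D0 by hring.
    rewrite !(rdot_sym _ (hplus v _)), !rdot_plus in D0.
    pose proof (norm_ge_0 x) as Nx; pose proof (norm_ge_0 (hminus y v)) as Ny.
    assert (CSm : forall p q : H, - (norm p * norm q) <= rdot p q).
    { intros p q; pose proof (rdot_le (hscal (RtoC (Ropp 1)) p) q) as T.
      rewrite rdot_scal, norm_scal_C, Cmod_R, Rabs_Ropp, Rabs_R1 in T; lra. }
    pose proof (CSm v x); pose proof (CSm (hminus y v) x).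
    pose proof (CSm (hminus y v) z); pose proof (CSm w x); pose proof (CSm w z).
    assert (norm v * norm x <= norm v * d) by (apply Rmult_le_compat_l; lra).
    assert (norm w * norm x <= norm w * d) by (apply Rmult_le_compat_l; lra).
    assert (norm (hminus y v) * norm z <= d * norm z)
      by (apply Rmult_le_compat_r; lra).
    assert (norm (hminus y v) * norm x <= 1 * d) by (apply Rmult_le_compat; lra).
    assert (S2 : s * rdot v z <= s * s * norm w * norm z + s * s).
    { assert (0 < d) by exact Hd.
      assert (Small : forall p q, 0 <= q -> - q <= p -> - q <= s * p) by (intros; nra).
      pose proof (Small (rdot (hminus y v) z) (d * norm z) ltac:(nra) ltac:(lra)).
      pose proof (Small (rdot w x) (norm w * d) ltac:(nra) ltac:(lra)).
      assert (s * s * - (norm w * norm z) <= s * s * rdot w z)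
        by (apply Rmult_le_compat_l; nra).
      unfold M in dM; nra. }
    nra. }
  destruct (Rle_lt_dec (rdot v z) 0) as [Q|Q]; [exact Q|exfalso].
  set (P := norm w * norm z + 1).
  assert (PP : 1 <= P) by (unfold P; nra).
  (* For this s the bound [K] reads rdot v z <= s P <= rdot v z / 2, impossible for a positive
     number. *)
  set (s := Rmin (1 / 2) (rdot v z / (2 * P))).
  assert (S1 : s <= 1 / 2) by apply Rmin_l.
  assert (S2 : s <= rdot v z / (2 * P)) by apply Rmin_r.
  assert (S0 : 0 < s).
  { apply Rmin_pos; [lra | apply Rdiv_lt_0_compat; lra]. }
  assert (S3 : s * P <= rdot v z / 2).
  { replace (rdot v z / 2) with (rdot v z / (2 * P) * P) by (field; lra).
    apply Rmult_le_compat_r; lra. }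
  pose proof (K s ltac:(lra)); unfold P in S3; nra. }
apply norm_minus_zero; fold v.
destruct (Rle_lt_or_eq_dec _ _ (norm_ge_0 v)) as [P|Z]; [exfalso|lra].
(* A domain element z with |z - v| < |v| satisfies 2 rdot v z > |z|^2 >= 0, against [Neg]. *)
destruct (A_dense v (mkposreal _ P)) as (z & w & Azw & N); simpl in N.
pose proof (Neg _ _ Azw) as Q; pose proof (pow2_ge_0 (norm z)).
pose proof (norm_minus_sqr z v) as E; rewrite (rdot_sym z v) in E.
pose proof (norm_ge_0 (hminus z v)); nra.
Qed.

Lemma op_closure_plus u v u' v' : op_closure A u v -> op_closure A u' v' ->
  op_closure A (hplus u u') (hplus v v').
Proof.
intros C1 C2 d; assert (Hd : 0 < d / 2) by (pose proof (cond_pos d); lra).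
destruct (C1 (mkposreal _ Hd)) as (x1 & y1 & A1 & X1 & Y1).
destruct (C2 (mkposreal _ Hd)) as (x2 & y2 & A2 & X2 & Y2).
cbn [pos] in *.
exists (hplus x1 x2), (hplus y1 y2); split; [apply A_plus; assumption|].
assert (E : forall a b a' b' : H,
  hminus (hplus a b) (hplus a' b') = hplus (hminus a a') (hminus b b'))
  by (intros; hring).
split; rewrite E; eapply Rle_lt_trans; try apply norm_plus_le; lra.
Qed.

Lemma op_closure_scal (c : C) u v : op_closure A u v ->
  op_closure A (hscal c u) (hscal c v).
Proof.
intros C1 d; pose proof (Cmod_ge_0 c) as Nc.
assert (Hd : 0 < d / (Cmod c + 1))
  by (apply Rdiv_lt_0_compat; [apply cond_pos | lra]).
destruct (C1 (mkposreal _ Hd)) as (x & y & Axy & X & Y); cbn [pos] in *.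
exists (hscal c x), (hscal c y); split; [apply A_scal; assumption|].
assert (E : forall a b : H, hminus (hscal c a) (hscal c b) = hscal c (hminus a b))
  by (intros; hring).
assert (D : d / (Cmod c + 1) * (Cmod c + 1) = d) by (field; lra).
split; rewrite E, norm_scal_C.
- pose proof (norm_ge_0 (hminus x u)); nra.
- pose proof (norm_ge_0 (hminus y v)); nra.
Qed.

(** * Adding the bounded operator: bounds, surjectivity and inverse *)

Hypothesis B_linear : is_linear B.

Lemma B_minus u v : B (hminus u v) = hminus (B u) (B v).
Proof.
replace (hminus u v) with (hplus u (hscal (RtoC (Ropp 1)) v))
  by (rewrite RtoC_opp; hring).
etransitivity; [exact (linear_plus B B_linear _ _)|].
replace (B (hscal (RtoC (Ropp 1)) v)) with (hscal (RtoC (Ropp 1)) (B v))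
  by (symmetry; exact (linear_scal B B_linear _ _)).
rewrite RtoC_opp; hring.
Qed.

Lemma op_plus_closure_plus u v u' v' :
  op_plus (op_closure A) B u v -> op_plus (op_closure A) B u' v' ->
  op_plus (op_closure A) B (hplus u u') (hplus v v').
Proof.
intros (w & C1 & ->) (w' & C2 & ->); exists (hplus w w'); split.
- apply op_closure_plus; assumption.
- replace (B (hplus u u')) with (hplus (B u) (B u'))
    by (symmetry; exact (linear_plus B B_linear _ _)).
  hring.
Qed.

Lemma op_plus_closure_scal (c : C) u v :
  op_plus (op_closure A) B u v ->
  op_plus (op_closure A) B (hscal c u) (hscal c v).
Proof.
intros (w & C1 & ->); exists (hscal c w); split.
- apply op_closure_scal; assumption.
- replace (B (hscal c u)) with (hscal c (B u))
    by (symmetry; exact (linear_scal B B_linear _ _)).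
  hring.
Qed.

Context (e : R) (l : C).
Hypothesis e_pos : 0 < e.
Hypothesis l_right : - (1 / 2) + e <= Re l.
Hypothesis range_dense : forall (f : H) (d : posreal),
  exists u v, A u v /\ norm (hminus (hminus (hscal l u) v) f) < d.
Hypothesis B_small : forall u v, A u v ->
  norm (B u) <= 1 / 2 * norm (hminus (hscal l u) v).

Let P (u v : H) : H := hminus (hminus (hscal l u) v) (B u).

(** With F = l u - v, smallness of [B] leaves |F - B u| >= |F| / 2, and |F| >= e |u| by
    dissipativity. *)
Lemma perturbed_lower_bound u v : A u v -> e / 2 * norm u <= norm (P u v).
Proof.
intros Auv; pose proof (dissipative_lower_bound l u v Auv) as L1.
pose proof (B_small u v Auv) as L2.
pose proof (norm_minus_ge (hminus (hscal l u) v) (B u)) as L3; fold (P u v) in L3.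
pose proof (norm_ge_0 u); nra.
Qed.

(* Each round solves the unperturbed equation approximately for the current
   residual; the perturbation then returns at most 3/4 of it. *)
Lemma perturbed_residual (f : H) (n : nat) :
  exists u v, A u v /\ norm (hminus f (P u v)) <= (3 / 4) ^ n * norm f.
Proof.
induction n as [|n (u & v & Auv & N)].
(* Any element of the graph will do here: scaled by 0 it gives the pair (0, 0), whose residual is
   f. *)
- destruct (range_dense f (mkposreal 1 Rlt_0_1)) as (u & v & Auv & _).
  exists (hscal (RtoC 0) u), (hscal (RtoC 0) v); split; [apply A_scal, Auv|].
  replace (hminus f (P (hscal (RtoC 0) u) (hscal (RtoC 0) v))) with f; [simpl; lra|].
  unfold P; replace (B (hscal (RtoC 0) u)) with (hscal (RtoC 0) (B u))
    by (symmetry; exact (linear_scal B B_linear _ _)).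
  hring.
- set (g := hminus f (P u v)) in *.
  destruct (Rle_lt_or_eq_dec _ _ (norm_ge_0 g)) as [Pg|Zg].
  (* With |z - g| < |g| / 10 one has |z| < 11/10 |g|, so the new residual is at most (1/10 + 11/20)
     |g|, below 3/4 |g|. *)
  + assert (Hd : 0 < norm g / 10) by lra.
    destruct (range_dense g (mkposreal _ Hd)) as (x & y & Axy & X); cbn [pos] in X.
    exists (hplus u x), (hplus v y); split; [apply A_plus; assumption|].
    set (z := hminus (hscal l x) y) in *.
    replace (hminus f (P (hplus u x) (hplus v y))) with (hplus (hminus g z) (B x)).
    * pose proof (norm_plus_le (hminus g z) (B x)) as T.
      rewrite (norm_minus_swap g z) in T.
      pose proof (B_small x y Axy) as T2; fold z in T2.
      pose proof (norm_minus_ge z g); simpl; lra.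
    * unfold g, z, P.
      replace (B (hplus u x)) with (hplus (B u) (B x))
        by (symmetry; exact (linear_plus B B_linear _ _)).
      hring.
  + exists u, v; split; [exact Auv|]; fold g; rewrite <- Zg.
    apply Rmult_le_pos; [apply pow_le; lra | apply norm_ge_0].
Qed.

Lemma perturbed_range_dense (f : H) (d : posreal) :
  exists u v, A u v /\ norm (hminus f (P u v)) < d.
Proof.
assert (K : 0 < d / (norm f + 1)).
{ apply Rdiv_lt_0_compat; [apply cond_pos | pose proof (norm_ge_0 f); lra]. }
destruct (pow_lt_1_zero (3 / 4) ltac:(rewrite Rabs_right; lra) _ K) as [n Hn].
specialize (Hn n (le_n n)).
assert (0 <= (3 / 4) ^ n) by (apply pow_le; lra).
rewrite Rabs_right in Hn by lra.
destruct (perturbed_residual f n) as (u & v & Auv & N).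
exists u, v; split; [exact Auv|].
assert (E : d / (norm f + 1) * (norm f + 1) = d)
  by (field; pose proof (norm_ge_0 f); lra).
pose proof (norm_ge_0 f); nra.
Qed.

Lemma perturbed_closure_lower_bound u v : op_plus (op_closure A) B u v ->
  e / 2 * norm u <= norm (hminus (hscal l u) v).
Proof.
intros (w & C1 & ->); apply Rnot_lt_le; intros Hlt.
destruct (linear_norm B B_linear) as (M & PM & HM).
set (gap := e / 2 * norm u - norm (hminus (hscal l u) (hplus w (B u)))).
(* Moving from (u, w) to a graph element within d changes the two sides by at most d times these
   four constants: e/2 for the left-hand side, then |l|, 1 and M for the terms l u, w and B u. The
   choice d = gap / K closes the gap. *)
set (K := e / 2 + Cmod l + 1 + M).
assert (PK : 0 < K) by (unfold K; pose proof (Cmod_ge_0 l); lra).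
assert (Hd : 0 < gap / K) by (apply Rdiv_lt_0_compat; unfold gap; lra).
destruct (C1 (mkposreal _ Hd)) as (x & y & Axy & X & Y); cbn [pos] in *.
pose proof (perturbed_lower_bound x y Axy) as LB.
assert (N1 : norm u <= norm x + norm (hminus x u)).
{ pose proof (norm_minus_ge u x); rewrite (norm_minus_swap u x) in *; lra. }
assert (E : P x y = hminus (hplus (hminus (hscal l u) (hplus w (B u)))
    (hscal l (hminus x u))) (hplus (hminus y w) (B (hminus x u)))).
{ unfold P; rewrite B_minus; hring. }
set (q := hminus (hscal l u) (hplus w (B u))) in *.
assert (N2 : norm (P x y) <=
  norm q + Cmod l * norm (hminus x u) + (norm (hminus y w) + M * norm (hminus x u))).
{ rewrite E.
  pose proof (norm_minus_trans (hplus q (hscal l (hminus x u))) hzero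
    (hplus (hminus y w) (B (hminus x u)))) as T.
  rewrite (norm_minus_swap hzero) in T.
  assert (Z : forall a : H, hminus a hzero = a) by (intros; hring).
  rewrite !Z in T.
  pose proof (norm_plus_le q (hscal l (hminus x u))) as T1.
  rewrite norm_scal_C in T1.
  pose proof (norm_plus_le (hminus y w) (B (hminus x u))) as T2.
  pose proof (HM (hminus x u)) as T3.
  eapply Rle_trans; [exact T|]; apply Rplus_le_compat; [exact T1|].
  eapply Rle_trans; [exact T2|]; apply Rplus_le_compat_l; exact T3. }
assert (GK : gap / K * K = gap) by (field; lra).
set (d := gap / K) in *.
pose proof (Cmod_ge_0 l); pose proof (norm_ge_0 (hminus x u)).
assert (Cmod l * norm (hminus x u) <= Cmod l * d) by nra.
assert (M * norm (hminus x u) <= M * d) by nra.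
unfold K, gap in *; nra.
Qed.

(** The approximate solutions of (l - A - B) u = f generate a filter, and the lower bound applied to
    differences makes it Cauchy. Using the filter itself means that no sequence of solutions has to
    be chosen. *)
Lemma perturbed_surjective (f : H) :
  exists u v, op_plus (op_closure A) B u v /\ hminus (hscal l u) v = f.
Proof.
set (F := fun Q : H -> Prop => exists d : posreal, forall u v,
  A u v -> norm (hminus f (P u v)) < d -> Q u).
assert (PF : ProperFilter F).
{ split.
  - intros Q (d & Hd); destruct (perturbed_range_dense f d) as (u & v & Auv & N).
    exists u; eapply Hd; eassumption.
  - split.
    + exists (mkposreal 1 Rlt_0_1); trivial.
    + intros Q1 Q2 (d1 & D1) (d2 & D2).
      assert (Hd : 0 < Rmin d1 d2) by (apply Rmin_pos; apply cond_pos).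
      exists (mkposreal _ Hd); cbn [pos]; intros u v Auv N; split.
      * apply (D1 u v Auv); eapply Rlt_le_trans; [exact N | apply Rmin_l].
      * apply (D2 u v Auv); eapply Rlt_le_trans; [exact N | apply Rmin_r].
    + intros Q1 Q2 I (d & D); exists d; intros u v Auv N; apply I.
      eapply D; eassumption. }
assert (CF : cauchy (T := hsort H) F).
{ intros d.
  (* Two residuals below e d / 4 differ by less than e d / 2, so [perturbed_lower_bound] places the
     two solutions at distance below d. *)
  assert (Hd : 0 < e / 2 * d / 2).
  { pose proof (cond_pos d); apply Rdiv_lt_0_compat; nra. }
  set (r := mkposreal _ Hd).
  destruct (perturbed_range_dense f r) as (x & y & Axy & X).
  exists x, r; intros u v Auv N; cbn [pos r] in *.
  apply (norm_compat1 (V := hsort H)).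
  change (norm (hminus u x) < d).
  assert (Am : A (hplus u (hscal (RtoC (Ropp 1)) x)) (hplus v (hscal (RtoC (Ropp 1)) y)))
    by (apply A_plus; [|apply A_scal]; assumption).
  apply perturbed_lower_bound in Am.
  replace (hplus u (hscal (RtoC (Ropp 1)) x)) with (hminus u x) in Am
    by (rewrite RtoC_opp; hring).
  replace (P (hminus u x) (hplus v (hscal (RtoC (Ropp 1)) y)))
    with (hminus (hminus f (P x y)) (hminus f (P u v))) in Am
    by (unfold P; rewrite B_minus, RtoC_opp; hring).
  pose proof (norm_minus_trans (hminus f (P x y)) hzero (hminus f (P u v))) as T.
  rewrite (norm_minus_swap hzero) in T.
  assert (Z : forall a : H, hminus a hzero = a) by (intros; hring).
  rewrite !Z in T.
  nra. }
set (u := lim (T := hsort H) F).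
assert (LF : forall d : posreal, F (ball (M := hsort H) u d))
  by exact (complete_cauchy (T := hsort H) F PF CF).
destruct (linear_norm B B_linear) as (M & PM & HM).
exists u, (hminus (hscal l u) f); split; [|hring].
exists (hminus (hminus (hscal l u) f) (B u)); split; [|hring].
intros d.
(* The error in the second component is at most the residual plus (|l| + M) |x - u|. With all of
   these below d / (2 K) the total is below d / 2, and K >= 1 takes care of the first component. *)
set (K := Cmod l + 1 + M).
assert (PK : 1 <= K) by (unfold K; pose proof (Cmod_ge_0 l); lra).
pose proof (cond_pos d) as Pd.
assert (Hd : 0 < d / (2 * K)) by (apply Rdiv_lt_0_compat; lra).
assert (PN : 0 < norm_factor (V := hsort H)) by apply norm_factor_gt_0.
(* Balls of the uniform structure and balls of the norm are comparable only up to [norm_factor]. *)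
assert (Hb : 0 < d / (2 * K) / norm_factor (V := hsort H))
  by (apply Rdiv_lt_0_compat; assumption).
destruct (LF (mkposreal _ Hb)) as (r & Hr).
(* The minimum serves both needs: below r the approximate solution lies in the ball around the
   limit, below d / (2 K) its residual is negligible. *)
assert (Hm : 0 < Rmin r (d / (2 * K))) by (apply Rmin_pos; [apply cond_pos | exact Hd]).
destruct (perturbed_range_dense f (mkposreal _ Hm)) as (x & y & Axy & N).
cbn [pos] in N.
pose proof (Rmin_l r (d / (2 * K))); pose proof (Rmin_r r (d / (2 * K))).
pose proof (Hr x y Axy ltac:(lra)) as Bx.
apply (norm_compat2 (V := hsort H)) in Bx; cbn [pos] in Bx.
change (norm (hminus x u) <
  norm_factor (V := hsort H) * (d / (2 * K) / norm_factor (V := hsort H))) in Bx.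
replace (norm_factor (V := hsort H) * (d / (2 * K) / norm_factor (V := hsort H)))
  with (d / (2 * K)) in Bx by (field; lra).
assert (DK : d / (2 * K) * K = d / 2) by (field; lra).
set (t := d / (2 * K)) in *.
exists x, y; split; [exact Axy|]; split; [nra|].
replace (hminus y (hminus (hminus (hscal l u) f) (B u)))
  with (hplus (hminus f (P x y)) (hplus (hscal l (hminus x u)) (hscal (RtoC (Ropp 1)) (B (hminus x u)))))
  by (unfold P; rewrite B_minus, RtoC_opp; hring).
pose proof (norm_plus_le (hminus f (P x y)) (hplus (hscal l (hminus x u))
  (hscal (RtoC (Ropp 1)) (B (hminus x u))))) as T1.
pose proof (norm_plus_le (hscal l (hminus x u))
  (hscal (RtoC (Ropp 1)) (B (hminus x u)))) as T2.
rewrite !norm_scal_C, Cmod_R, Rabs_Ropp, Rabs_R1, Rmult_1_l in T2.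
assert (T3 : norm (B (hminus x u)) <= M * norm (hminus x u)) by apply HM.
pose proof (norm_ge_0 (hminus x u)); pose proof (Cmod_ge_0 l).
assert (Cmod l * norm (hminus x u) <= Cmod l * t) by nra.
assert (M * norm (hminus x u) <= M * t) by nra.
unfold K in DK; nra.
Qed.

Lemma perturbed_resolvent_bound RL :
  is_resolvent (op_plus (op_closure A) B) l RL ->
  forall f, norm (RL f) <= 2 / e * norm f.
Proof.
intros (_ & R2 & _) f; destruct (R2 f) as (v & C1 & E).
pose proof (perturbed_closure_lower_bound _ _ C1) as LB.
change (hminus (hscal l (RL f)) v = f) in E; rewrite E in LB.
apply Rmult_le_reg_l with (e / 2); [lra|].
replace (e / 2 * (2 / e * norm f)) with (norm f) by (field; lra); exact LB.
Qed.

Lemma perturbed_injective u v u' v' :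
  op_plus (op_closure A) B u v -> op_plus (op_closure A) B u' v' ->
  hminus (hscal l u) v = hminus (hscal l u') v' -> u = u'.
Proof.
intros C1 C2 E; apply norm_minus_zero.
pose proof (op_plus_closure_plus _ _ _ _ C1
  (op_plus_closure_scal (RtoC (Ropp 1)) _ _ C2)) as C3.
apply perturbed_closure_lower_bound in C3.
replace (hplus u (hscal (RtoC (Ropp 1)) u')) with (hminus u u') in C3
  by (rewrite RtoC_opp; hring).
replace (hminus (hscal l (hminus u u')) (hplus v (hscal (RtoC (Ropp 1)) v')))
  with (hminus (hminus (hscal l u) v) (hminus (hscal l u') v')) in C3
  by (rewrite RtoC_opp; hring).
rewrite E in C3.
(* The zero vector is written as a multiple by 0 so that [norm_scal_C] evaluates its norm. *)
replace (hminus (hminus (hscal l u') v') (hminus (hscal l u') v'))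
  with (hscal (RtoC 0) u) in C3 by hring.
rewrite norm_scal_C, Cmod_0, Rmult_0_l in C3.
pose proof (norm_ge_0 (hminus u u')); nra.
Qed.

(** Solutions exist and are unique, so the inverse is defined by description; its linearity is
    uniqueness applied to sums and multiples of solutions, its boundedness the lower bound.
    Single-valuedness of the sum is closability of [A]. *)
Lemma perturbed_resolvent_set : resolvent_set (op_plus (op_closure A) B) l.
Proof.
set (G := op_plus (op_closure A) B).
set (T := fun f : H =>
  iota (T := hsort H) (fun u => exists v, G u v /\ hminus (hscal l u) v = f)).
assert (Tspec : forall f, exists v, G (T f) v /\ hminus (hscal l (T f)) v = f).
{ intros f; unfold T.
  apply (iota_correct (V := hsort H)
    (fun u => exists v, G u v /\ hminus (hscal l u) v = f)).
  destruct (perturbed_surjective f) as (u & v & C1 & E).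
  exists u; split; [exists v; split; assumption|].
  intros u' (v' & C2 & E'); apply (perturbed_injective _ _ _ _ C1 C2).
  congruence. }
assert (Tuniq : forall f u v, G u v -> hminus (hscal l u) v = f -> T f = u).
{ intros f u v C1 E; destruct (Tspec f) as (v' & C2 & E').
  apply (perturbed_injective _ _ _ _ C2 C1); congruence. }
split.
- intros u v v' (w & C1 & ->) (w' & C2 & ->).
  rewrite (dissipative_closable _ _ _ C1 C2); reflexivity.
- exists T; split; [split|split].
  + intros f g; destruct (Tspec f) as (v & C1 & E1), (Tspec g) as (w & C2 & E2).
    apply (Tuniq _ _ _ (op_plus_closure_plus _ _ _ _ C1 C2)).
    transitivity (hplus (hminus (hscal l (T f)) v) (hminus (hscal l (T g)) w));
      [hring | rewrite E1, E2; reflexivity].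
  + intros c f; destruct (Tspec f) as (v & C1 & E1).
    apply (Tuniq _ _ _ (op_plus_closure_scal c _ _ C1)).
    transitivity (hscal c (hminus (hscal l (T f)) v));
      [hring | rewrite E1; reflexivity].
  + exists (2 / e); split; [apply Rdiv_lt_0_compat; lra|].
    intros f; destruct (Tspec f) as (v & C1 & E1).
    apply perturbed_closure_lower_bound in C1; rewrite E1 in C1.
    apply Rmult_le_reg_l with (e / 2); [lra|].
    replace (e / 2 * (2 / e * norm f)) with (norm f) by (field; lra); exact C1.
  + exact Tspec.
  + intros u v C1; exact (Tuniq _ _ _ C1 eq_refl).
Qed.

Lemma perturbed_resolvent_norm RL :
  is_resolvent (op_plus (op_closure A) B) l RL ->
  Rbar_le (op_norm RL) (2 / e).
Proof.
intros HR; unfold op_norm.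
apply (proj2 (Lub_Rbar_correct
  (fun r => exists f, norm f <= 1 /\ r = norm (RL f)))).
intros r (f & N & ->); simpl.
pose proof (perturbed_resolvent_bound RL HR f) as Bd.
assert (0 < 2 / e) by (apply Rdiv_lt_0_compat; lra).
pose proof (norm_ge_0 f); nra.
Qed.

End Resolvent.

(** * Regularity on [0,1] *)

(* The domain (-1, oo) contains [0,1] in its interior and is where
   [(1 + x)^(- l - 1)] is smooth. *)
Fixpoint Ckr (k : nat) (f : R -> R) : Prop :=
  match k with
  | O => forall x, -1 < x -> continuous f x
  | S k' => exists f' : R -> R, (forall x, -1 < x -> is_derive f x (f' x)) /\ Ckr k' f'
  end.

Lemma Ckr_continuous k f : Ckr k f -> forall x, -1 < x -> continuous f x.
Proof.
destruct k; [trivial|]; intros (f' & D & _) x Hx.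
apply (ex_derive_continuous f); exists (f' x); apply D, Hx.
Qed.

Lemma Ckr_pred k f : Ckr (S k) f -> Ckr k f.
Proof.
revert f; induction k; intros f Hf.
- exact (Ckr_continuous _ _ Hf).
- destruct Hf as (f' & D & C); exists f'; split; [exact D | apply IHk, C].
Qed.

Lemma Ckr_le j k f : (j <= k)%nat -> Ckr k f -> Ckr j f.
Proof. induction 1; [trivial | intros Hf; apply IHle, Ckr_pred, Hf]. Qed.

Lemma locally_gt (c x : R) : c < x -> locally x (fun y => c < y).
Proof. exact (open_gt c x). Qed.

Lemma Ckr_ext k f g : (forall x, -1 < x -> f x = g x) -> Ckr k f -> Ckr k g.
Proof.
intros E; assert (L : forall x, -1 < x -> locally x (fun y => f y = g y)).
{ intros x Hx; generalize (locally_gt _ _ Hx); apply filter_imp; exact E. }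
destruct k.
- intros C x Hx; apply continuous_ext_loc with f; [apply L, Hx | apply C, Hx].
- intros (f' & D & C); exists f'; split; [|exact C].
  intros x Hx; apply is_derive_ext_loc with f; [apply L, Hx | apply D, Hx].
Qed.

Lemma Ckr_derive k f f' : Ckr (S k) f ->
  (forall x, -1 < x -> is_derive f x (f' x)) -> Ckr k f'.
Proof.
intros (f1 & D1 & C1) D; apply Ckr_ext with f1; [|exact C1].
intros x Hx; rewrite <- (is_derive_unique _ _ _ (D1 x Hx)).
apply is_derive_unique, D, Hx.
Qed.

Lemma Ckr_plus k f g : Ckr k f -> Ckr k g -> Ckr k (fun x => f x + g x).
Proof.
revert f g; induction k; intros f g.
- intros Cf Cg x Hx; apply (continuous_plus f g); auto.
- intros (f' & Df & Cf) (g' & Dg & Cg); exists (fun x => f' x + g' x); split.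
  + intros x Hx; apply (is_derive_plus f g); auto.
  + apply IHk; assumption.
Qed.

Lemma Ckr_mult k f g : Ckr k f -> Ckr k g -> Ckr k (fun x => f x * g x).
Proof.
revert f g; induction k; intros f g.
- intros Cf Cg x Hx; apply (continuous_mult f g); auto.
- intros Cf Cg; pose proof (Ckr_pred _ _ Cf) as Cf0; pose proof (Ckr_pred _ _ Cg) as Cg0.
  destruct Cf as (f' & Df & Cf), Cg as (g' & Dg & Cg).
  exists (fun x => f' x * g x + f x * g' x); split.
  + intros x Hx; apply (is_derive_mult f g); auto using Rmult_comm.
  + apply Ckr_plus; apply IHk; assumption.
Qed.

Lemma Ckr_const k c : Ckr k (fun _ => c).
Proof.
revert c; induction k; intros c.
- intros x _; apply continuous_const.
- exists (fun _ => 0); split; [|apply IHk].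
  intros x _; apply (is_derive_const c x).
Qed.

Lemma Ckr_id k : Ckr k (fun x => x).
Proof.
destruct k.
- intros x _; apply continuous_id.
- exists (fun _ => 1); split; [|apply Ckr_const].
  intros x _; apply (is_derive_id x).
Qed.

Lemma Ckr_opp k f : Ckr k f -> Ckr k (fun x => - f x).
Proof.
intros Cf; apply Ckr_ext with (fun x => -1 * f x); [intros; ring|].
apply Ckr_mult; [apply Ckr_const | exact Cf].
Qed.

Lemma Ckr_minus k f g : Ckr k f -> Ckr k g -> Ckr k (fun x => f x - g x).
Proof. intros Cf Cg; apply Ckr_plus; [|apply Ckr_opp]; assumption. Qed.

Lemma Ckr_inv k f : (forall x, -1 < x -> f x <> 0) -> Ckr k f ->
  Ckr k (fun x => / f x).
Proof.
intros Nz; revert f Nz; induction k; intros f Nz.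
- intros Cf x Hx; apply (continuous_comp f Rinv); [apply Cf, Hx|].
  apply continuity_pt_filterlim, (continuity_pt_inv (fun x => x)).
  + apply derivable_continuous_pt, derivable_pt_id.
  + apply Nz, Hx.
- intros Cf; pose proof (Ckr_pred _ _ Cf) as Cf0.
  destruct Cf as (f' & Df & Cf).
  exists (fun x => (- f' x) * (/ f x * / f x)); split.
  + intros x Hx; specialize (Nz x Hx); specialize (Df x Hx).
    replace (- f' x * (/ f x * / f x)) with (- f' x / (f x) ^ 2) by (field; exact Nz).
    apply is_derive_inv; assumption.
  + apply Ckr_mult; [apply Ckr_opp, Cf|].
    apply Ckr_mult; apply IHk; assumption.
Qed.

Lemma Ckr_sqr k f : Ckr k f -> Ckr k (fun x => f x ^ 2).
Proof.
intros Cf; apply Ckr_ext with (fun x => f x * f x); [intros; ring|].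
apply Ckr_mult; exact Cf.
Qed.

Ltac Ckr_tac :=
  repeat first [ assumption | apply Ckr_sqr | apply Ckr_plus | apply Ckr_minus
    | apply Ckr_mult | apply Ckr_opp | apply Ckr_const | apply Ckr_id ].

(* [(1 + x)^(p + i q)], through the linear system satisfied by its parts. *)
Definition cpow_re (p q x : R) : R := exp (p * ln (1 + x)) * cos (q * ln (1 + x)).
Definition cpow_im (p q x : R) : R := exp (p * ln (1 + x)) * sin (q * ln (1 + x)).

Lemma is_derive_cpow_re p q x : -1 < x ->
  is_derive (cpow_re p q) x (/ (1 + x) * (p * cpow_re p q x - q * cpow_im p q x)).
Proof.
intros Hx; unfold cpow_re, cpow_im; auto_derive; [lra|]; field; lra.
Qed.

Lemma is_derive_cpow_im p q x : -1 < x ->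
  is_derive (cpow_im p q) x (/ (1 + x) * (p * cpow_im p q x + q * cpow_re p q x)).
Proof.
intros Hx; unfold cpow_re, cpow_im; auto_derive; [lra|]; field; lra.
Qed.

Lemma Ckr_cpow k p q : Ckr k (cpow_re p q) /\ Ckr k (cpow_im p q).
Proof.
induction k as [|k [IHr IHi]].
- split; intros x Hx.
  + apply (ex_derive_continuous (cpow_re p q)); eexists; apply is_derive_cpow_re, Hx.
  + apply (ex_derive_continuous (cpow_im p q)); eexists; apply is_derive_cpow_im, Hx.
- assert (I : Ckr k (fun x => / (1 + x))) by (apply Ckr_inv; [intros; lra | Ckr_tac]).
  split.
  + exists (fun x => / (1 + x) * (p * cpow_re p q x - q * cpow_im p q x)); split.
    * intros x Hx; apply is_derive_cpow_re, Hx.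
    * Ckr_tac.
  + exists (fun x => / (1 + x) * (p * cpow_im p q x + q * cpow_re p q x)); split.
    * intros x Hx; apply is_derive_cpow_im, Hx.
    * Ckr_tac.
Qed.

Lemma continuous_ex_RInt f a b : -1 < a -> -1 < b -> Ckr 0 f -> ex_RInt f a b.
Proof.
intros Ha Hb Cf; apply (ex_RInt_continuous (V := R_CompleteNormedModule)).
intros x Hx; apply Cf.
apply Rlt_le_trans with (Rmin a b); [apply Rmin_glb_lt; assumption | apply Hx].
Qed.

Lemma Ckr_primitive f c : Ckr 0 f ->
  exists F : R -> R, F 0 = c /\ forall x, -1 < x -> is_derive F x (f x).
Proof.
intros Cf; exists (fun x => c + RInt f 0 x); split.
- rewrite RInt_point; unfold zero; simpl; ring.
- intros x Hx.
  replace (f x) with (0 + f x) by ring.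
  apply (is_derive_plus (fun _ => c) (fun x => RInt f 0 x)).
  + apply (is_derive_const c x).
  + apply (is_derive_RInt f (fun x => RInt f 0 x) 0).
    * assert (P : 0 < x + 1) by lra.
      exists (mkposreal _ P); intros y Hy.
      unfold ball in Hy; simpl in Hy; unfold AbsRing_ball, abs, minus, plus, opp in Hy; simpl in Hy.
      apply Rabs_def2 in Hy.
      apply (RInt_correct f), continuous_ex_RInt; [lra | lra | exact Cf].
    * apply Cf, Hx.
Qed.

Lemma FTC f F a b : -1 < a -> -1 < b -> Ckr 0 f ->
  (forall x, -1 < x -> is_derive F x (f x)) -> RInt f a b = F b - F a.
Proof.
intros Ha Hb Cf D; apply is_RInt_unique.
apply (is_RInt_derive F f); intros x Hx.
- apply D; apply Rlt_le_trans with (Rmin a b); [apply Rmin_glb_lt; assumption | apply Hx].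
- apply Cf; apply Rlt_le_trans with (Rmin a b); [apply Rmin_glb_lt; assumption | apply Hx].
Qed.

(** * Derivatives relative to [0,1], and extension of C^k functions beyond it *)

Definition deriv_within (f : R -> R) (x l : R) : Prop :=
  forall e, 0 < e -> exists d, 0 < d /\ forall y, I01 y -> Rabs (y - x) < d ->
    Rabs (f y - f x - (y - x) * l) <= e * Rabs (y - x).

Lemma Rabs_le_sqrt_sum a b : Rabs a <= sqrt (Rabs a ^ 2 + Rabs b ^ 2).
Proof.
pose proof (Rabs_pos a); pose proof (Rabs_pos b).
rewrite <- (sqrt_pow2 (Rabs a)) at 1 by assumption.
apply sqrt_le_1_alt; nra.
Qed.

Lemma sqrt_sum_le a b : sqrt (Rabs a ^ 2 + Rabs b ^ 2) <= Rabs a + Rabs b.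
Proof.
pose proof (Rabs_pos a); pose proof (Rabs_pos b).
rewrite <- (sqrt_pow2 (Rabs a + Rabs b)) by lra.
apply sqrt_le_1_alt; nra.
Qed.

Lemma is_deriv01_components u x l : I01 x -> is_deriv01 u x l ->
  deriv_within (fun y => fst (u y)) x (fst l) /\
  deriv_within (fun y => snd (u y)) x (snd l).
Proof.
intros Ix [_ D].
assert (F : is_filter_lim (within I01 (locally x)) x).
{ intros P HP; apply filter_le_within; exact HP. }
specialize (D x F).
assert (K : forall e, 0 < e -> exists d, 0 < d /\ forall y, I01 y -> Rabs (y - x) < d ->
  sqrt (Rabs (fst (u y) - fst (u x) - (y - x) * fst l) ^ 2 +
        Rabs (snd (u y) - snd (u x) - (y - x) * snd l) ^ 2) <= e * Rabs (y - x)).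
{ intros e He; destruct (D (mkposreal e He)) as [d Hd].
  exists d; split; [apply cond_pos|]; intros y Iy Hy.
  exact (Hd y Hy Iy). }
split; intros e He; destruct (K e He) as (d & Pd & Hd); exists d; (split; [exact Pd|]);
  intros y Iy Hy; eapply Rle_trans; try (apply Hd; assumption).
- apply Rabs_le_sqrt_sum.
- rewrite Rplus_comm; apply Rabs_le_sqrt_sum.
Qed.

Lemma is_deriv01_intro u x l : I01 x ->
  deriv_within (fun y => fst (u y)) x (fst l) ->
  deriv_within (fun y => snd (u y)) x (snd l) -> is_deriv01 u x l.
Proof.
intros Ix D1 D2; split.
- split.
  + intros h k; exact (scal_distr_r h k (l : C_R_NormedModule)).
  + intros h k; symmetry; exact (scal_assoc h k (l : C_R_NormedModule)).
  + exists (norm (l : C_R_NormedModule) + 1).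
    pose proof (norm_ge_0 (l : C_R_NormedModule)) as N.
    split; [lra|]; intros h.
    eapply Rle_trans; [exact (norm_scal (V := C_R_NormedModule) h l)|].
    change (Rabs h * norm (l : C_R_NormedModule) <=
      (norm (l : C_R_NormedModule) + 1) * Rabs h).
    pose proof (Rabs_pos h); nra.
- intros x' F.
  (* [filterdiff] asks for the estimate at every limit point of the filter. As x lies in [0,1], it
     belongs to every set of that filter, so x is the only limit point. *)
  assert (x = x').
  { destruct (Req_dec x x') as [E|E]; [exact E|exfalso].
    assert (P : 0 < Rabs (x - x')) by (apply Rabs_pos_lt; lra).
    destruct (F (fun y => Rabs (y - x') < Rabs (x - x'))) as [d Hd].
    { exists (mkposreal _ P); intros y Hy; exact Hy. }
    specialize (Hd x (ball_center x d) Ix); lra. }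
  subst x'; intros e.
  assert (He : 0 < e / 2) by (pose proof (cond_pos e); lra).
  destruct (D1 _ He) as (d1 & P1 & H1), (D2 _ He) as (d2 & P2 & H2).
  assert (Pd : 0 < Rmin d1 d2) by (apply Rmin_pos; assumption).
  exists (mkposreal _ Pd); intros y Hy Iy.
  change (Rabs (y - x) < Rmin d1 d2) in Hy.
  specialize (H1 y Iy (Rlt_le_trans _ _ _ Hy (Rmin_l _ _))).
  specialize (H2 y Iy (Rlt_le_trans _ _ _ Hy (Rmin_r _ _))).
  change (sqrt (Rabs (fst (u y) - fst (u x) - (y - x) * fst l) ^ 2 +
    Rabs (snd (u y) - snd (u x) - (y - x) * snd l) ^ 2) <= e * Rabs (y - x)).
  eapply Rle_trans; [apply sqrt_sum_le | lra].
Qed.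

Lemma deriv_within_unique f x l1 l2 : I01 x ->
  deriv_within f x l1 -> deriv_within f x l2 -> l1 = l2.
Proof.
intros Ix D1 D2; apply cond_eq; intros e He.
assert (He' : 0 < e / 4) by lra.
destruct (D1 _ He') as (d1 & P1 & H1), (D2 _ He') as (d2 & P2 & H2).
assert (Pd : 0 < Rmin (Rmin d1 d2) (1 / 2)) by (repeat apply Rmin_pos; lra).
set (d := Rmin (Rmin d1 d2) (1 / 2)) in *.
assert (Dl : d <= Rmin d1 d2 /\ d <= 1 / 2) by (split; [apply Rmin_l | apply Rmin_r]).
assert (Dm : Rmin d1 d2 <= d1 /\ Rmin d1 d2 <= d2) by (split; [apply Rmin_l | apply Rmin_r]).
(* Every point of [0,1] can be approached from inside: to the right from the left half, to the left
   otherwise. The cap d <= 1/2 keeps y in the interval. *)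
assert (E : exists y, I01 y /\ Rabs (y - x) < d /\ y <> x).
{ destruct (Rle_lt_dec x (1 / 2)).
  - exists (x + d / 2); unfold I01 in *; split; [lra|].
    replace (x + d / 2 - x) with (d / 2) by ring.
    rewrite Rabs_right by lra; lra.
  - exists (x - d / 2); unfold I01 in *; split; [lra|].
    replace (x - d / 2 - x) with (- (d / 2)) by ring.
    rewrite Rabs_Ropp, Rabs_right by lra; lra. }
destruct E as (y & Iy & Hy & Ny).
specialize (H1 y Iy ltac:(lra)); specialize (H2 y Iy ltac:(lra)).
assert (P : 0 < Rabs (y - x)) by (apply Rabs_pos_lt; lra).
assert (Q : Rabs ((y - x) * (l1 - l2)) <= e / 2 * Rabs (y - x)).
{ replace ((y - x) * (l1 - l2)) with
    ((f y - f x - (y - x) * l2) - (f y - f x - (y - x) * l1)) by ring.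
  eapply Rle_trans; [apply Rabs_triang|]; rewrite Rabs_Ropp; lra. }
rewrite Rabs_mult in Q; nra.
Qed.

Lemma is_deriv01_unique u x l : I01 x -> is_deriv01 u x l -> D01 u x = l.
Proof.
intros Ix D; unfold D01.
apply (iota_unique (V := C_R_CompleteNormedModule)); [|exact D].
intros l' D'.
apply (is_deriv01_components _ _ _ Ix) in D; apply (is_deriv01_components _ _ _ Ix) in D'.
apply injective_projections;
  [apply (deriv_within_unique (fun y => fst (u y)) x)
  |apply (deriv_within_unique (fun y => snd (u y)) x)]; tauto.
Qed.

Lemma deriv_within_ext f g x l : I01 x -> (forall y, I01 y -> f y = g y) ->
  deriv_within f x l -> deriv_within g x l.
Proof.
intros Ix E D e He; destruct (D e He) as (d & Pd & Hd).
exists d; split; [exact Pd|]; intros y Iy Hy.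
rewrite <- !E by assumption; apply Hd; assumption.
Qed.

Lemma is_derive_within f x l : is_derive f x l -> deriv_within f x l.
Proof.
intros [_ D] e He.
destruct (D x (fun P HP => HP) (mkposreal e He)) as [d Hd].
exists d; split; [apply cond_pos|]; intros y _ Hy; exact (Hd y Hy).
Qed.

(** Replaces a function known on [0,1] by real functions on a larger open set, so that ordinary
    two-sided calculus applies at the endpoints too. *)
Definition agrees (u : R -> C) (f g : R -> R) : Prop :=
  forall x, I01 x -> u x = (f x, g x).

Lemma agrees_deriv01 u f g f' g' x : agrees u f g -> I01 x ->
  is_derive f x f' -> is_derive g x g' -> is_deriv01 u x (f', g').
Proof.
intros E Ix Df Dg; apply is_deriv01_intro; [exact Ix| |].
- apply (deriv_within_ext f); [exact Ix | | apply is_derive_within, Df].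
  intros y Iy; rewrite E by exact Iy; reflexivity.
- apply (deriv_within_ext g); [exact Ix | | apply is_derive_within, Dg].
  intros y Iy; rewrite E by exact Iy; reflexivity.
Qed.

Lemma I01_gt x : I01 x -> -1 < x.
Proof. unfold I01; lra. Qed.

Lemma agrees_D01 u f g f' g' : agrees u f g ->
  (forall x, -1 < x -> is_derive f x (f' x)) ->
  (forall x, -1 < x -> is_derive g x (g' x)) -> agrees (D01 u) f' g'.
Proof.
intros E Df Dg x Ix; apply is_deriv01_unique; [exact Ix|].
apply (agrees_deriv01 u f g); auto using I01_gt.
Qed.

Lemma Ck01_intro k u f g : agrees u f g -> Ckr k f -> Ckr k g -> Ck01 k u.
Proof.
revert u f g; induction k as [|k IHk]; intros u f g E.
- intros Cf Cg x Ix; rewrite E by exact Ix.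
  intros P [e He]; unfold filtermap.
  assert (Ef := Cf x (I01_gt x Ix) (ball (f x) e) (locally_ball _ _)).
  assert (Eg := Cg x (I01_gt x Ix) (ball (g x) e) (locally_ball _ _)).
  unfold filtermap in Ef, Eg; unfold within.
  generalize (filter_and _ _ Ef Eg); apply filter_imp.
  intros y [By1 By2] Iy; apply He; rewrite E by exact Iy; split; assumption.
- intros (f' & Df & Cf) (g' & Dg & Cg); split.
  + intros x Ix; exists (f' x, g' x); apply (agrees_deriv01 u f g); auto using I01_gt.
  + apply (IHk _ f' g'); auto; apply (agrees_D01 u f g); auto.
Qed.

Definition clamp (x : R) : R := Rmax 0 (Rmin x 1).

Lemma clamp_I01 x : I01 (clamp x).
Proof.
unfold clamp, I01; split; [apply Rmax_l|].
apply Rmax_lub; [lra | apply Rmin_r].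
Qed.

Lemma clamp_id x : I01 x -> clamp x = x.
Proof.
unfold clamp, I01; intros Hx; rewrite Rmin_left, Rmax_right; lra.
Qed.

Lemma clamp_contracts x y : Rabs (clamp x - clamp y) <= Rabs (x - y).
Proof.
unfold clamp, Rmax, Rmin; repeat destruct Rle_dec; unfold Rabs;
  repeat destruct Rcase_abs; lra.
Qed.

(* Composed with the clamp, the function has zero two-sided derivative on R. *)
Lemma deriv_within_zero h : (forall x, I01 x -> deriv_within h x 0) ->
  forall x, I01 x -> h x = h 0.
Proof.
intros D.
assert (Z : forall x, is_derive (fun y => h (clamp y)) x 0).
{ intros x; apply is_derive_Reals; intros e He.
  assert (He' : 0 < e / 2) by lra.
  destruct (D _ (clamp_I01 x) _ He') as (d & Pd & Hd).
  exists (mkposreal d Pd); intros t Nt Ht; cbn [pos] in Ht.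
  pose proof (clamp_contracts (x + t) x) as Cl.
  replace (x + t - x) with t in Cl by ring.
  specialize (Hd _ (clamp_I01 (x + t)) ltac:(lra)).
  rewrite Rmult_0_r, Rminus_0_r in Hd.
  rewrite Rminus_0_r; unfold Rdiv; rewrite Rabs_mult, Rabs_inv.
  pose proof (Rabs_pos_lt t Nt) as Pt.
  apply Rmult_lt_reg_r with (Rabs t); [exact Pt|].
  rewrite Rmult_assoc, Rinv_l, Rmult_1_r by lra; nra. }
intros x Ix.
assert (I0 : I01 0) by (unfold I01; lra).
rewrite <- (clamp_id x Ix), <- (clamp_id 0 I0) at 1.
destruct (MVT_gen (fun y => h (clamp y)) 0 x (fun _ => 0)) as (c & _ & E).
- intros; apply Z.
- intros y _; apply continuity_pt_filterlim.
  apply (ex_derive_continuous (fun y => h (clamp y))); exists 0; apply Z.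
- rewrite (clamp_id 0 I0) in *; lra.
Qed.

Lemma continuous_on_clamp u : continuous_on (T := R_UniformSpace) (U := C_UniformSpace) I01 u ->
  forall x, continuous (fun y => fst (u (clamp y))) x /\
            continuous (fun y => snd (u (clamp y))) x.
Proof.
intros Cu x.
assert (K : forall e : posreal, locally x (fun y =>
  ball (M := C_UniformSpace) (u (clamp x)) e (u (clamp y)))).
{ intros e.
  destruct (Cu (clamp x) (clamp_I01 x) _ (locally_ball (T := C_UniformSpace) _ e)) as [d Hd].
  exists d; intros y Hy; apply Hd; [|apply clamp_I01].
  eapply Rle_lt_trans; [apply clamp_contracts | exact Hy]. }
split; intros P [e He]; unfold filtermap; generalize (K e); apply filter_imp;
  intros y [B1 B2]; apply He; assumption.
Qed.

(** The derivative of highest order is extended by its endpoint values, through [clamp], and then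
    integrated back k times. At each stage u and the primitive have the same relative derivative and
    the same value at 0, hence coincide on [0,1]. *)
Lemma Ck01_extend k u : Ck01 k u ->
  exists f g, Ckr k f /\ Ckr k g /\ agrees u f g.
Proof.
revert u; induction k as [|k IHk]; intros u.
- intros Cu; exists (fun y => fst (u (clamp y))), (fun y => snd (u (clamp y))).
  split; [|split].
  + intros x _; apply continuous_on_clamp, Cu.
  + intros x _; apply continuous_on_clamp, Cu.
  + intros x Ix; rewrite clamp_id by exact Ix; destruct (u x); reflexivity.
- intros [Du Cu]; destruct (IHk _ Cu) as (f' & g' & Cf & Cg & E).
  destruct (Ckr_primitive f' (fst (u 0)) (Ckr_continuous _ _ Cf)) as (f & f0 & Df).
  destruct (Ckr_primitive g' (snd (u 0)) (Ckr_continuous _ _ Cg)) as (g & g0 & Dg).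
  exists f, g; split; [exists f'; split; assumption|].
  split; [exists g'; split; assumption|].
  assert (D : forall x, I01 x -> is_deriv01 u x (f' x, g' x)).
  { intros x Ix; destruct (Du x Ix) as [l Hl].
    rewrite <- E by exact Ix; rewrite (is_deriv01_unique _ _ _ Ix Hl); exact Hl. }
  assert (Z : forall (h p : R -> R) (l : R -> R),
    (forall x, I01 x -> deriv_within h x (l x)) ->
    (forall x, -1 < x -> is_derive p x (l x)) -> p 0 = h 0 ->
    forall x, I01 x -> h x = p x).
  { intros h p l Dh Dp p0 x Ix.
    cut (h x - p x = h 0 - p 0); [lra|].
    apply (deriv_within_zero (fun y => h y - p y)); [|exact Ix].
    intros y Iy e He; assert (He' : 0 < e / 2) by lra.
    destruct (Dh y Iy _ He') as (d1 & P1 & H1).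
    destruct (is_derive_within _ _ _ (Dp y (I01_gt y Iy)) _ He') as (d2 & P2 & H2).
    exists (Rmin d1 d2); split; [apply Rmin_pos; assumption|]; intros z Iz Hz.
    specialize (H1 z Iz (Rlt_le_trans _ _ _ Hz (Rmin_l _ _))).
    specialize (H2 z Iz (Rlt_le_trans _ _ _ Hz (Rmin_r _ _))).
    replace (h z - p z - (h y - p y) - (z - y) * 0) with
      ((h z - h y - (z - y) * l y) - (p z - p y - (z - y) * l y)) by ring.
    eapply Rle_trans; [apply Rabs_triang|]; rewrite Rabs_Ropp; lra. }
  intros x Ix; apply injective_projections; simpl.
  + apply (Z (fun y => fst (u y)) f f'); auto.
    intros y Iy; exact (proj1 (is_deriv01_components _ _ _ Iy (D y Iy))).
  + apply (Z (fun y => snd (u y)) g g'); auto.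
    intros y Iy; exact (proj2 (is_deriv01_components _ _ _ Iy (D y Iy))).
Qed.

Lemma Ckr_S_intro k f f' : (forall x, -1 < x -> is_derive f x (f' x)) ->
  Ckr k f' -> Ckr (S k) f.
Proof. intros D C; exists f'; split; assumption. Qed.

(** Agreement is asked on the open interval only: at 0 the integrand of [ip1] takes the value 0,
    while its continuous representative need not vanish there. *)
Lemma CInt_pair f F G a b : -1 < a -> a <= b -> Ckr 0 F -> Ckr 0 G ->
  (forall x, a < x < b -> f x = (F x, G x)) ->
  CInt f a b = (RInt F a b, RInt G a b).
Proof.
intros Ha Hab CF CG E; unfold CInt.
apply (is_RInt_unique (V := C_R_CompleteNormedModule)).
apply (is_RInt_ext (V := C_R_NormedModule) (fun x => (F x, G x))).
- rewrite Rmin_left, Rmax_right by assumption; intros x Hx; rewrite E by exact Hx; reflexivity.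
- apply (is_RInt_fct_extend_pair (U := R_NormedModule) (V := R_NormedModule));
    apply (RInt_correct (V := R_CompleteNormedModule));
    apply continuous_ex_RInt; first [lra | assumption].
Qed.

(* Difference quotients at 0: [w(x) / x], completed by [w'(0)]. *)
Definition hadamard (w : R -> R) (w1 : R) (x : R) : R :=
  if Req_EM_T x 0 then w1 else w x / x.

Lemma hadamard_eq w w1 x : w 0 = 0 -> w x = x * hadamard w w1 x.
Proof.
intros w0; unfold hadamard; destruct Req_EM_T as [->|N]; [lra | field; exact N].
Qed.

Lemma hadamard_0 w w1 : hadamard w w1 0 = w1.
Proof. unfold hadamard; destruct Req_EM_T; [reflexivity | lra]. Qed.

Lemma continuous_eps (f : R -> R) x : continuous f x <->
  forall e, 0 < e -> exists d, 0 < d /\ forall y, Rabs (y - x) < d -> Rabs (f y - f x) < e.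
Proof.
split.
- intros Cf e He.
  destruct (Cf _ (locally_ball (f x) (mkposreal e He))) as [d Hd].
  exists d; split; [apply cond_pos|]; intros y Hy; exact (Hd y Hy).
- intros K P [e He]; destruct (K e (cond_pos e)) as (d & Pd & Hd).
  exists (mkposreal d Pd); intros y Hy; apply He, Hd, Hy.
Qed.

Lemma locally_neq (x : R) : x <> 0 -> locally x (fun y => y <> 0).
Proof.
intros N; assert (P : 0 < Rabs x) by (apply Rabs_pos_lt, N).
exists (mkposreal _ P); intros y Hy Z; subst y.
change (Rabs (0 - x) < Rabs x) in Hy.
rewrite Rminus_0_l, Rabs_Ropp in Hy; lra.
Qed.

Lemma hadamard_continuous w w' : Ckr 0 w -> w 0 = 0 -> is_derive w 0 w' ->
  Ckr 0 (hadamard w w').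
Proof.
intros Cw w0 D x Hx; destruct (Req_EM_T x 0) as [->|N].
- apply continuous_eps; intros e He.
  apply is_derive_Reals in D; destruct (D e He) as [d Hd].
  exists d; split; [apply cond_pos|]; intros y Hy.
  rewrite Rminus_0_r in Hy; rewrite hadamard_0.
  unfold hadamard; destruct Req_EM_T as [->|Ny].
  + replace (w' - w') with 0 by ring; rewrite Rabs_R0; exact He.
  + specialize (Hd y Ny Hy); rewrite w0, Rplus_0_l, Rminus_0_r in Hd; exact Hd.
- apply continuous_ext_loc with (fun y => w y * / y).
  + generalize (locally_neq x N); apply filter_imp; intros y Ny.
    unfold hadamard; destruct Req_EM_T; [contradiction | reflexivity].
  + apply (continuous_mult w Rinv); [apply Cw, Hx|].
    apply continuity_pt_filterlim, (continuity_pt_inv (fun y => y)); [|exact N].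
    apply derivable_continuous_pt, derivable_pt_id.
Qed.

(** Mean value theorem for N - c(0) x^2 / 2, whose derivative is x (c(x) - c(0)). *)
Lemma quadratic_remainder N c : (forall x, -1 < x -> is_derive N x (x * c x)) ->
  N 0 = 0 -> continuous c 0 ->
  forall e, 0 < e -> exists d, 0 < d /\ d <= 1 /\ forall x, Rabs x < d ->
    Rabs (N x - x ^ 2 * (c 0 / 2)) <= e * x ^ 2.
Proof.
intros D N0 Cc e He; destruct (proj1 (continuous_eps c 0) Cc e He) as (d & Pd & Hd).
exists (Rmin d 1); split; [apply Rmin_pos; lra|]; split; [apply Rmin_r|].
intros x Hx.
pose proof (Rmin_l d 1); pose proof (Rmin_r d 1).
assert (S : forall y, Rmin 0 x <= y <= Rmax 0 x -> Rabs y <= Rabs x).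
{ intros y; unfold Rmin, Rmax, Rabs; repeat destruct Rle_dec; repeat destruct Rcase_abs; lra. }
assert (S1 : forall y, Rabs y <= Rabs x -> -1 < y).
{ intros y Hy; assert (Hy' : Rabs y < 1) by lra; apply Rabs_def2 in Hy'; lra. }
assert (DD : forall y, -1 < y ->
  is_derive (fun y => N y - y ^ 2 * (c 0 / 2)) y (y * c y - y * c 0)).
{ intros y Hy; apply (is_derive_minus N (fun y => y ^ 2 * (c 0 / 2))); [apply D, Hy|].
  auto_derive; [trivial | field]. }
destruct (MVT_gen (fun y => N y - y ^ 2 * (c 0 / 2)) 0 x (fun y => y * c y - y * c 0))
  as (t & Ht & E).
- intros y Hy; apply DD, S1, S; lra.
- intros y Hy; apply continuity_pt_filterlim.
  apply (ex_derive_continuous (fun y => N y - y ^ 2 * (c 0 / 2))).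
  eexists; apply DD, S1, S, Hy.
- apply S in Ht.
  replace (N x - x ^ 2 * (c 0 / 2)) with (t * (c t - c 0) * x)
    by (rewrite N0 in E; replace (0 ^ 2) with 0 in E by ring; lra).
  rewrite 2!Rabs_mult.
  specialize (Hd t); rewrite Rminus_0_r in Hd; specialize (Hd ltac:(lra)).
  replace (x ^ 2) with (Rabs x * Rabs x) by (rewrite <- Rabs_mult, Rabs_right; [ring | nra]).
  pose proof (Rabs_pos t); pose proof (Rabs_pos x); pose proof (Rabs_pos (c t - c 0)).
  assert (Rabs t * Rabs (c t - c 0) <= Rabs x * e) by (apply Rmult_le_compat; lra).
  nra.
Qed.

(** Only the point 0 is at issue. Differentiability of w / x there concerns N = w - x w'(0),
    continuity of its derivative concerns N = x w' - w. In both cases N' = x c with c(0) = w''(0),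
    so [quadratic_remainder] gives the common limit w''(0) / 2. *)
Lemma hadamard_C1 w : Ckr 2 w -> w 0 = 0 ->
  exists a, Ckr 1 a /\ (forall x, w x = x * a x) /\ is_derive w 0 (a 0).
Proof.
intros (w1 & D1 & w2 & D2 & C2) w0.
assert (H0 : -1 < 0) by lra.
assert (C1 : Ckr 0 w1) by (apply (Ckr_pred 0); exists w2; split; assumption).
exists (hadamard w (w1 0)).
split; [|split; [intros x; apply hadamard_eq, w0 | rewrite hadamard_0; apply D1, H0]].
set (c := hadamard (fun x => w1 x - w1 0) (w2 0)).
assert (Cc : Ckr 0 c).
{ apply hadamard_continuous; [apply Ckr_minus; [exact C1 | apply Ckr_const] | ring |].
  replace (w2 0) with (w2 0 - 0) by ring.
  apply (is_derive_minus w1 (fun _ => w1 0)); [apply D2, H0|].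
  apply (is_derive_const (w1 0) 0). }
assert (c0 : c 0 = w2 0) by apply hadamard_0.
set (a1 := fun x => if Req_EM_T x 0 then w2 0 / 2 else (x * w1 x - w x) / x ^ 2).
assert (a10 : a1 0 = w2 0 / 2) by (unfold a1; destruct Req_EM_T; [reflexivity | lra]).
exists a1; split.
- intros x Hx; destruct (Req_EM_T x 0) as [->|N].
  + rewrite a10; apply is_derive_Reals; intros e He.
    assert (He' : 0 < e / 2) by lra.
    destruct (quadratic_remainder (fun x => w x - x * w1 0) c) with (e := e / 2)
      as (d & Pd & _ & Hd); try lra.
    * intros y Hy; replace (y * c y) with (w1 y - w1 0)
        by (apply (hadamard_eq (fun x => w1 x - w1 0)); ring).
      apply (is_derive_minus w (fun y => y * w1 0)); [apply D1, Hy|].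
      auto_derive; [trivial | ring].
    * apply Cc, H0.
    * rewrite c0 in Hd; exists (mkposreal d Pd); intros h Nh Hh; cbn [pos] in Hh.
      specialize (Hd h Hh); rewrite Rplus_0_l, hadamard_0.
      unfold hadamard; destruct Req_EM_T as [|_]; [contradiction|].
      replace ((w h / h - w1 0) / h - w2 0 / 2)
        with ((w h - h * w1 0 - h ^ 2 * (w2 0 / 2)) * / h ^ 2) by (field; exact Nh).
      assert (P : 0 < h ^ 2) by (apply pow2_gt_0, Nh).
      rewrite Rabs_mult, Rabs_inv, (Rabs_right (h ^ 2)) by lra.
      apply Rmult_lt_reg_r with (h ^ 2); [exact P|].
      rewrite Rmult_assoc, Rinv_l, Rmult_1_r by lra; nra.
  + apply is_derive_ext_loc with (fun y => w y / y).
    * generalize (locally_neq x N); apply filter_imp; intros y Ny.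
      unfold hadamard; destruct Req_EM_T; [contradiction | reflexivity].
    * unfold a1; destruct Req_EM_T as [|_]; [contradiction|].
      replace ((x * w1 x - w x) / x ^ 2) with ((w1 x * x - w x * 1) / x ^ 2)
        by (field; exact N).
      apply (is_derive_div w (fun y => y)); [apply D1, Hx | apply (is_derive_id x) | exact N].
- intros x Hx; destruct (Req_EM_T x 0) as [->|N].
  + apply continuous_eps; intros e He; rewrite a10.
    assert (He' : 0 < e / 2) by lra.
    destruct (quadratic_remainder (fun x => x * w1 x - w x) w2) with (e := e / 2)
      as (d & Pd & _ & Hd); try lra.
    * intros y Hy; replace (y * w2 y) with ((1 * w1 y + y * w2 y) - w1 y) by ring.
      apply (is_derive_minus (fun y => y * w1 y) w); [|apply D1, Hy].
      apply (is_derive_mult (fun y => y) w1);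
        [apply (is_derive_id y) | apply D2, Hy | apply Rmult_comm].
    * apply C2, H0.
    * exists d; split; [exact Pd|]; intros y Hy; rewrite Rminus_0_r in Hy.
      unfold a1; destruct Req_EM_T as [Zy|Ny].
      { replace (w2 0 / 2 - w2 0 / 2) with 0 by ring; rewrite Rabs_R0; exact He. }
      specialize (Hd y Hy).
      replace ((y * w1 y - w y) / y ^ 2 - w2 0 / 2)
        with ((y * w1 y - w y - y ^ 2 * (w2 0 / 2)) * / y ^ 2) by (field; exact Ny).
      assert (P : 0 < y ^ 2) by (apply pow2_gt_0, Ny).
      rewrite Rabs_mult, Rabs_inv, (Rabs_right (y ^ 2)) by lra.
      apply Rmult_lt_reg_r with (y ^ 2); [exact P|].
      rewrite Rmult_assoc, Rinv_l, Rmult_1_r by lra; nra.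
  + apply continuous_ext_loc with (fun y => (y * w1 y - w y) * / y ^ 2).
    * generalize (locally_neq x N); apply filter_imp; intros y Ny.
      unfold a1; destruct Req_EM_T; [contradiction | reflexivity].
    * assert (Cw : continuous w x)
        by (apply (ex_derive_continuous w); eexists; apply D1, Hx).
      apply (continuous_mult (fun y => y * w1 y - w y) (fun y => / y ^ 2)).
      -- apply (continuous_minus (fun y => y * w1 y) w); [|exact Cw].
         apply (continuous_mult (fun y => y) w1); [apply continuous_id | apply C1, Hx].
      -- apply (ex_derive_continuous (fun y => / y ^ 2)).
         auto_derive; apply Rmult_integral_contrapositive; split; lra.
Qed.

(** * The spaces H1 and H2 as L^2 spaces *)

(* With u'(x) = x (a + i b), the norm |u|_1 is the L^2 norm of a + i b. *)
Definition profile1 (u : R -> C) (a b : R -> R) : Prop :=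
  tH1 u /\ Ckr 0 a /\ Ckr 0 b /\ agrees (D01 u) (fun x => x * a x) (fun x => x * b x).

Definition profile2 (u : R -> C) (a b : R -> R) : Prop :=
  tH2 u /\ Ckr 0 a /\ Ckr 0 b /\ agrees (D01 u) a b.

Lemma I01_0 : I01 0.
Proof. unfold I01; lra. Qed.

Lemma agrees_at (u : R -> C) f g x : agrees u f g -> I01 x ->
  f x = Re (u x) /\ g x = Im (u x).
Proof. intros E Ix; rewrite E by exact Ix; split; reflexivity. Qed.

Lemma profile1_intro u f g a b : agrees u f g -> Ckr 2 f -> Ckr 2 g ->
  f 0 = 0 -> g 0 = 0 -> Ckr 0 a -> Ckr 0 b ->
  (forall x, -1 < x -> is_derive f x (x * a x)) ->
  (forall x, -1 < x -> is_derive g x (x * b x)) -> profile1 u a b.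
Proof.
intros E Cf Cg f0 g0 Ca Cb Df Dg.
pose proof (agrees_D01 _ _ _ _ _ E Df Dg) as ED.
split; [|split; [|split]]; try assumption.
split; [apply (Ck01_intro 2 u f g); assumption|].
rewrite E, ED by apply I01_0; rewrite f0, g0, !Rmult_0_l; split; reflexivity.
Qed.

Lemma profile2_intro u f g a b : agrees u f g ->
  f 0 = 0 -> g 0 = 0 -> Ckr 0 a -> Ckr 0 b ->
  (forall x, -1 < x -> is_derive f x (a x)) ->
  (forall x, -1 < x -> is_derive g x (b x)) -> profile2 u a b.
Proof.
intros E f0 g0 Ca Cb Df Dg.
pose proof (agrees_D01 _ _ _ _ _ E Df Dg) as ED.
split; [|split; [|split]]; try assumption.
split; [apply (Ck01_intro 1 u f g); try exact E; eapply Ckr_S_intro; eassumption|].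
rewrite E by apply I01_0; rewrite f0, g0; reflexivity.
Qed.

(** As u' is C^1 and vanishes at 0, the quotient u' / x extends continuously by u''(0). *)
Lemma tH1_profile u : tH1 u -> exists a b, profile1 u a b.
Proof.
intros (Cu & u0 & d0).
destruct (Ck01_extend 2 u Cu) as (f & g & (f' & Df & Cf) & (g' & Dg & Cg) & E).
pose proof (agrees_D01 _ _ _ _ _ E Df Dg) as ED.
destruct (agrees_at _ _ _ _ ED I01_0) as [f0 g0]; rewrite d0 in f0, g0; simpl in f0, g0.
pose proof (Ckr_pred _ _ Cf) as Cf0; pose proof (Ckr_pred _ _ Cg) as Cg0.
destruct Cf as (f2 & Df2 & _), Cg as (g2 & Dg2 & _).
exists (hadamard f' (f2 0)), (hadamard g' (g2 0)).
split; [split; [|split]; assumption|]; split; [|split].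
- apply hadamard_continuous; [assumption | assumption | apply Df2; lra].
- apply hadamard_continuous; [assumption | assumption | apply Dg2; lra].
- intros x Ix; rewrite <- !hadamard_eq by assumption; apply ED, Ix.
Qed.

Lemma tH2_profile u : tH2 u -> exists a b, profile2 u a b.
Proof.
intros (Cu & u0).
destruct (Ck01_extend 1 u Cu) as (f & g & (f' & Df & Cf) & (g' & Dg & Cg) & E).
exists f', g'; split; [split; assumption|]; split; [|split]; try assumption.
exact (agrees_D01 _ _ _ _ _ E Df Dg).
Qed.

Lemma agrees_plus u v f g h k : agrees u f g -> agrees v h k ->
  agrees (fun r => u r + v r)%C (fun x => f x + h x) (fun x => g x + k x).
Proof. intros E F x Ix; rewrite E, F by exact Ix; reflexivity. Qed.

Lemma agrees_scal (c : C) u f g : agrees u f g ->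
  agrees (fun r => c * u r)%C
    (fun x => Re c * f x - Im c * g x) (fun x => Re c * g x + Im c * f x).
Proof. intros E x Ix; rewrite E by exact Ix; reflexivity. Qed.

Lemma Ck01_plus k u v : Ck01 (S k) u -> Ck01 (S k) v ->
  Ck01 (S k) (fun r => u r + v r)%C /\
  forall x, I01 x -> D01 (fun r => u r + v r)%C x = (D01 u x + D01 v x)%C.
Proof.
intros Cu Cv.
destruct (Ck01_extend _ _ Cu) as (f & g & Cf & Cg & E).
destruct (Ck01_extend _ _ Cv) as (h & p & Ch & Cp & F).
pose proof (agrees_plus _ _ _ _ _ _ E F) as EF; split.
- apply (Ck01_intro _ _ _ _ EF); apply Ckr_plus; assumption.
- destruct Cf as (f' & Df & _), Cg as (g' & Dg & _),
    Ch as (h' & Dh & _), Cp as (p' & Dp & _).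
  assert (D1 : forall x, -1 < x -> is_derive (fun x => f x + h x) x (f' x + h' x))
    by (intros x Hx; apply (is_derive_plus f h); auto).
  assert (D2 : forall x, -1 < x -> is_derive (fun x => g x + p x) x (g' x + p' x))
    by (intros x Hx; apply (is_derive_plus g p); auto).
  intros x Ix.
  rewrite (agrees_D01 _ _ _ _ _ EF D1 D2 x Ix), (agrees_D01 _ _ _ _ _ E Df Dg x Ix),
    (agrees_D01 _ _ _ _ _ F Dh Dp x Ix); reflexivity.
Qed.

Lemma Ck01_scal k (c : C) u : Ck01 (S k) u ->
  Ck01 (S k) (fun r => c * u r)%C /\
  forall x, I01 x -> D01 (fun r => c * u r)%C x = (c * D01 u x)%C.
Proof.
intros Cu.
destruct (Ck01_extend _ _ Cu) as (f & g & Cf & Cg & E).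
pose proof (agrees_scal c _ _ _ E) as EF; split.
- apply (Ck01_intro _ _ _ _ EF); Ckr_tac.
- destruct Cf as (f' & Df & _), Cg as (g' & Dg & _).
  assert (D1 : forall x, -1 < x ->
    is_derive (fun x => Re c * f x - Im c * g x) x (Re c * f' x - Im c * g' x)).
  { intros x Hx; apply (is_derive_minus (fun x => Re c * f x) (fun x => Im c * g x));
      apply is_derive_scal; auto. }
  assert (D2 : forall x, -1 < x ->
    is_derive (fun x => Re c * g x + Im c * f x) x (Re c * g' x + Im c * f' x)).
  { intros x Hx; apply (is_derive_plus (fun x => Re c * g x) (fun x => Im c * f x));
      apply is_derive_scal; auto. }
  intros x Ix.
  rewrite (agrees_D01 _ _ _ _ _ EF D1 D2 x Ix), (agrees_D01 _ _ _ _ _ E Df Dg x Ix).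
  reflexivity.
Qed.

Lemma profile1_plus u v a b c d : profile1 u a b -> profile1 v c d ->
  profile1 (fun r => u r + v r)%C (fun x => a x + c x) (fun x => b x + d x).
Proof.
intros ((Cu & u0 & du0) & Ca & Cb & E) ((Cv & v0 & dv0) & Cc & Cd & F).
destruct (Ck01_plus 1 u v Cu Cv) as [Cs Ds].
split; [split; [exact Cs|split]|split; [|split]]; try (apply Ckr_plus; assumption).
- rewrite u0, v0; ring.
- rewrite Ds, du0, dv0 by apply I01_0; ring.
- intros x Ix; rewrite Ds, E, F by exact Ix.
  apply injective_projections; simpl; ring.
Qed.

Lemma profile1_scal (z : C) u a b : profile1 u a b ->
  profile1 (fun r => z * u r)%C
    (fun x => Re z * a x - Im z * b x) (fun x => Re z * b x + Im z * a x).
Proof.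
intros ((Cu & u0 & du0) & Ca & Cb & E).
destruct (Ck01_scal 1 z u Cu) as [Cs Ds].
split; [split; [exact Cs|split]|split; [|split]]; try solve [Ckr_tac].
- rewrite u0; ring.
- rewrite Ds, du0 by apply I01_0; ring.
- intros x Ix; rewrite Ds, E by exact Ix.
  apply injective_projections; simpl; unfold Re, Im; ring.
Qed.

Lemma profile2_plus u v a b c d : profile2 u a b -> profile2 v c d ->
  profile2 (fun r => u r + v r)%C (fun x => a x + c x) (fun x => b x + d x).
Proof.
intros ((Cu & u0) & Ca & Cb & E) ((Cv & v0) & Cc & Cd & F).
destruct (Ck01_plus 0 u v Cu Cv) as [Cs Ds].
split; [split; [exact Cs|]|split; [|split]]; try (apply Ckr_plus; assumption).
- rewrite u0, v0; ring.
- intros x Ix; rewrite Ds, E, F by exact Ix; reflexivity.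
Qed.

Lemma profile2_scal (z : C) u a b : profile2 u a b ->
  profile2 (fun r => z * u r)%C
    (fun x => Re z * a x - Im z * b x) (fun x => Re z * b x + Im z * a x).
Proof.
intros ((Cu & u0) & Ca & Cb & E).
destruct (Ck01_scal 0 z u Cu) as [Cs Ds].
split; [split; [exact Cs|]|split; [|split]]; try solve [Ckr_tac].
- rewrite u0; ring.
- intros x Ix; rewrite Ds, E by exact Ix; reflexivity.
Qed.

(** * Inner products and norms expressed through profiles *)

Section Completion.

Context {H1 H2 : Hilbert} {j1 : (R -> C) -> H1} {j2 : (R -> C) -> H2}.
Hypothesis hH1 : is_completion tH1 ip1 H1 j1.
Hypothesis hH2 : is_completion tH2 ip2 H2 j2.

Lemma rdot_profile1 u v a b c d : profile1 u a b -> profile1 v c d ->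
  rdot (j1 u) (j1 v) = RInt (fun x => a x * c x + b x * d x) 0 1.
Proof.
intros (Tu & Ca & Cb & E) (Tv & Cc & Cd & F).
unfold rdot; rewrite (completion_dot _ _ _ _ hH1 u v Tu Tv); unfold ip1.
rewrite (CInt_pair _ (fun x => a x * c x + b x * d x) (fun x => b x * c x - a x * d x));
  [reflexivity | lra | lra | Ckr_tac | Ckr_tac |].
intros x Hx; assert (Ix : I01 x) by (unfold I01; lra).
rewrite E, F by exact Ix; apply injective_projections; simpl; field; lra.
Qed.

Lemma rdot_profile2 u v a b c d : profile2 u a b -> profile2 v c d ->
  rdot (j2 u) (j2 v) = RInt (fun x => a x * c x + b x * d x) 0 1.
Proof.
intros (Tu & Ca & Cb & E) (Tv & Cc & Cd & F).
unfold rdot; rewrite (completion_dot _ _ _ _ hH2 u v Tu Tv); unfold ip2.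
rewrite (CInt_pair _ (fun x => a x * c x + b x * d x) (fun x => b x * c x - a x * d x));
  [reflexivity | lra | lra | Ckr_tac | Ckr_tac |].
intros x Hx; assert (Ix : I01 x) by (unfold I01; lra).
rewrite E, F by exact Ix; apply injective_projections; simpl; ring.
Qed.

Lemma norm_profile1 u a b : profile1 u a b ->
  norm (j1 u) ^ 2 = RInt (fun x => a x ^ 2 + b x ^ 2) 0 1.
Proof.
intros P; rewrite <- rdot_norm, (rdot_profile1 _ _ _ _ _ _ P P).
apply RInt_ext; intros; simpl; ring.
Qed.

Lemma norm_profile2 u a b : profile2 u a b ->
  norm (j2 u) ^ 2 = RInt (fun x => a x ^ 2 + b x ^ 2) 0 1.
Proof.
intros P; rewrite <- rdot_norm, (rdot_profile2 _ _ _ _ _ _ P P).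
apply RInt_ext; intros; simpl; ring.
Qed.

Lemma norm_minus_profile1 u v a b c d : profile1 u a b -> profile1 v c d ->
  norm (hminus (j1 u) (j1 v)) ^ 2 = RInt (fun x => (a x - c x) ^ 2 + (b x - d x) ^ 2) 0 1.
Proof.
intros P Q; pose proof (profile1_scal (RtoC (Ropp 1)) _ _ _ Q) as Q'.
pose proof (profile1_plus _ _ _ _ _ _ P Q') as S.
replace (hminus (j1 u) (j1 v)) with (j1 (fun r => u r + RtoC (Ropp 1) * v r)%C).
- rewrite (norm_profile1 _ _ _ S); apply RInt_ext; intros; simpl; ring.
- rewrite (completion_plus _ _ _ _ hH1) by (apply P || apply Q').
  rewrite (completion_scal _ _ _ _ hH1) by apply Q.
  rewrite RtoC_opp; hring.
Qed.

Lemma norm_minus_profile2 u v a b c d : profile2 u a b -> profile2 v c d ->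
  norm (hminus (j2 u) (j2 v)) ^ 2 = RInt (fun x => (a x - c x) ^ 2 + (b x - d x) ^ 2) 0 1.
Proof.
intros P Q; pose proof (profile2_scal (RtoC (Ropp 1)) _ _ _ Q) as Q'.
pose proof (profile2_plus _ _ _ _ _ _ P Q') as S.
replace (hminus (j2 u) (j2 v)) with (j2 (fun r => u r + RtoC (Ropp 1) * v r)%C).
- rewrite (norm_profile2 _ _ _ S); apply RInt_ext; intros; simpl; ring.
- rewrite (completion_plus _ _ _ _ hH2) by (apply P || apply Q').
  rewrite (completion_scal _ _ _ _ hH2) by apply Q.
  rewrite RtoC_opp; hring.
Qed.

End Completion.

(** * The operators L0 and L' on the core *)

(* Real or imaginary part [(f, g)] of an element of the core, in the variables
   [a = f' / x] and [b = g'], where [L0] acts as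
   [(a, b) |-> (b' - (x a)', a' - (x b)')]. *)
Record core_data (f g a a' b b' : R -> R) : Prop := {
  core_f0 : f 0 = 0;
  core_g0 : g 0 = 0;
  core_a0 : a 0 = 0;
  core_f : forall x, -1 < x -> is_derive f x (x * a x);
  core_g : forall x, -1 < x -> is_derive g x (b x);
  core_a : forall x, -1 < x -> is_derive a x (a' x);
  core_b : forall x, -1 < x -> is_derive b x (b' x);
  core_xa_C2 : Ckr 2 (fun x => x * a x);
  core_b_C2 : Ckr 2 b;
  core_a'_C0 : Ckr 0 a';
  core_b'_C0 : Ckr 0 b'
}.

(* [auto_derive] leaves eta-expanded derivatives of the variable functions. *)
Ltac derive_at D :=
  let E := fresh in
  match type of D with is_derive ?f ?x ?l =>
    assert (E : Derive (fun y => f y) x = l) by exact (is_derive_unique f x l D);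
    rewrite E; clear E
  end.

Lemma is_derive_lin p q f g x f' g' : is_derive f x f' -> is_derive g x g' ->
  is_derive (fun x => p * f x + q * g x) x (p * f' + q * g').
Proof.
intros Df Dg; apply (is_derive_plus (fun x => p * f x) (fun x => q * g x));
  apply is_derive_scal; assumption.
Qed.

Lemma core_data_lin p q f g a a' b b' h k c c' d d' :
  core_data f g a a' b b' -> core_data h k c c' d d' ->
  core_data (fun x => p * f x + q * h x) (fun x => p * g x + q * k x)
    (fun x => p * a x + q * c x) (fun x => p * a' x + q * c' x)
    (fun x => p * b x + q * d x) (fun x => p * b' x + q * d' x).
Proof.
intros [F0 G0 A0 Df Dg Da Db Cxa Cb Ca' Cb'] [H0 L0 C0 Dh Dk Dc Dd Cxc Cd Cc' Cd'];
  constructor; try solve [Ckr_tac].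
- rewrite F0, H0; ring.
- rewrite G0, L0; ring.
- rewrite A0, C0; ring.
- intros x Hx; replace (x * (p * a x + q * c x)) with (p * (x * a x) + q * (x * c x)) by ring.
  apply is_derive_lin; auto.
- intros x Hx; apply is_derive_lin; auto.
- intros x Hx; apply is_derive_lin; auto.
- intros x Hx; apply is_derive_lin; auto.
- apply Ckr_ext with (fun x => p * (x * a x) + q * (x * c x)); [intros; ring | Ckr_tac].
Qed.

Section CoreData.

Context {f g a a' b b' : R -> R} (cd : core_data f g a a' b b').

Lemma core_a_C0 : Ckr 0 a.
Proof. apply (Ckr_pred 0); exists a'; split; apply cd. Qed.

Lemma core_b_C0 : Ckr 0 b.
Proof. apply (Ckr_le 0 2); [lia | apply cd]. Qed.

Lemma core_g_C2 : Ckr 2 g.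
Proof.
apply (Ckr_S_intro 1 g b); [apply cd | apply (Ckr_le 1 2); [lia | apply cd]].
Qed.

(* The integrand is the derivative of [a b - x (a^2 + b^2) / 2] minus
   [(a^2 + b^2) / 2], and the boundary term at 1 is [- (a - b)^2 / 2]. *)
Lemma core_dissipative :
  RInt (fun x => (b' x - a x - x * a' x) * a x + (a' x - b x - x * b' x) * b x) 0 1 <=
  - (1 / 2) * RInt (fun x => a x ^ 2 + b x ^ 2) 0 1.
Proof.
pose proof core_a_C0; pose proof core_b_C0.
destruct cd as [_ _ A0 _ _ Da Db _ _ Ca' Cb'].
set (F := fun x => (b' x - a x - x * a' x) * a x + (a' x - b x - x * b' x) * b x).
set (N := fun x => a x ^ 2 + b x ^ 2).
assert (CF : Ckr 0 F) by (unfold F; Ckr_tac).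
assert (CN : Ckr 0 N).
{ apply Ckr_ext with (fun x => a x * a x + b x * b x); [intros; unfold N; ring | Ckr_tac]. }
assert (E : RInt (fun x => F x + 1 / 2 * N x) 0 1 =
  (a 1 * b 1 - 1 / 2 * (a 1 ^ 2 + b 1 ^ 2)) - a 0 * b 0 :> R).
{ rewrite (FTC _ (fun x => a x * b x - x / 2 * (a x ^ 2 + b x ^ 2)));
    [field | lra | lra | Ckr_tac |].
  intros x Hx; specialize (Da x Hx); specialize (Db x Hx).
  auto_derive; [repeat split; trivial; eexists; eassumption|].
  derive_at Da; derive_at Db.
  unfold F, N; field. }
assert (S : RInt (fun x => F x + 1 / 2 * N x) 0 1 = RInt F 0 1 + 1 / 2 * RInt N 0 1 :> R).
{ assert (EN : ex_RInt N 0 1) by (apply continuous_ex_RInt; [lra | lra | exact CN]).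
  rewrite (RInt_plus (V := R_CompleteNormedModule) F (fun x => 1 / 2 * N x)).
  - rewrite (RInt_scal (V := R_CompleteNormedModule) N); [reflexivity | exact EN].
  - apply continuous_ex_RInt; [lra | lra | exact CF].
  - apply continuous_ex_RInt; [lra | lra | Ckr_tac]. }
(* The boundary term at 0 is a(0) b(0), and it vanishes by the condition a(0) = 0 of the core. *)
rewrite A0 in E; pose proof (pow2_ge_0 (a 1 - b 1)); lra.
Qed.

End CoreData.

Lemma core_dom u1 u2 f1 g1 a1 a1' b1 b1' f2 g2 a2 a2' b2 b2' :
  agrees u1 f1 f2 -> agrees u2 g1 g2 ->
  core_data f1 g1 a1 a1' b1 b1' -> core_data f2 g2 a2 a2' b2 b2' -> dom_tL0 u1 u2.
Proof.
intros E F K1 K2.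
assert (D2 : forall f g a a' b b', core_data f g a a' b b' ->
  forall x, -1 < x -> is_derive (fun x => x * a x) x (a x + x * a' x)).
{ intros f g a a' b b' K x Hx.
  replace (a x + x * a' x) with (1 * a x + x * a' x) by ring.
  apply (is_derive_mult (fun x => x) a);
    [apply (is_derive_id x) | apply K, Hx | apply Rmult_comm]. }
pose proof (agrees_D01 _ _ _ _ _ E (core_f _ _ _ _ _ _ K1) (core_f _ _ _ _ _ _ K2)) as E1.
pose proof (agrees_D01 _ _ _ _ _ E1 (D2 _ _ _ _ _ _ K1) (D2 _ _ _ _ _ _ K2)) as E2.
split; [split; [|split; [|split]]|split].
- apply (Ck01_intro 3 u1 f1 f2 E).
  + exact (Ckr_S_intro 2 _ _ (core_f _ _ _ _ _ _ K1) (core_xa_C2 _ _ _ _ _ _ K1)).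
  + exact (Ckr_S_intro 2 _ _ (core_f _ _ _ _ _ _ K2) (core_xa_C2 _ _ _ _ _ _ K2)).
- rewrite E, (core_f0 _ _ _ _ _ _ K1), (core_f0 _ _ _ _ _ _ K2) by apply I01_0; reflexivity.
- rewrite E1, !Rmult_0_l by apply I01_0; reflexivity.
- rewrite E2, (core_a0 _ _ _ _ _ _ K1), (core_a0 _ _ _ _ _ _ K2), !Rmult_0_l, Rplus_0_l
    by apply I01_0; reflexivity.
- apply (Ck01_intro 3 u2 g1 g2 F).
  + exact (Ckr_S_intro 2 _ _ (core_g _ _ _ _ _ _ K1) (core_b_C2 _ _ _ _ _ _ K1)).
  + exact (Ckr_S_intro 2 _ _ (core_g _ _ _ _ _ _ K2) (core_b_C2 _ _ _ _ _ _ K2)).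
- rewrite F, (core_g0 _ _ _ _ _ _ K1), (core_g0 _ _ _ _ _ _ K2) by apply I01_0; reflexivity.
Qed.

(** Here a = f' / x, which is C^1 because f' is C^2 and vanishes at 0. Its value at 0 is f''(0), so
    the third boundary condition of the domain is exactly a(0) = 0. *)
Lemma core_data_intro (f g f' f'' g' : R -> R) : f 0 = 0 -> g 0 = 0 -> f' 0 = 0 -> f'' 0 = 0 ->
  (forall x, -1 < x -> is_derive f x (f' x)) ->
  (forall x, -1 < x -> is_derive f' x (f'' x)) -> Ckr 1 f'' ->
  (forall x, -1 < x -> is_derive g x (g' x)) -> Ckr 2 g' ->
  exists a a' b b', core_data f g a a' b b'.
Proof.
intros f0 g0 f10 f20 Df Df' Cf'' Dg Cg'.
assert (C2 : Ckr 2 f') by (exists f''; split; assumption).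
destruct (hadamard_C1 f' C2 f10) as (a & (a' & Da & Ca') & Ea & D0).
destruct Cg' as (b' & Db & Cb').
exists a, a', g', b'; constructor; try assumption.
- apply is_derive_unique in D0; rewrite <- D0.
  rewrite (is_derive_unique f' 0 _ (Df' 0 ltac:(lra))); exact f20.
- intros x Hx; rewrite <- Ea; apply Df, Hx.
- apply Ckr_ext with f'; [intros; apply Ea | exact C2].
- exists b'; split; assumption.
- apply Ckr_pred, Cb'.
Qed.

Lemma dom_core u1 u2 : dom_tL0 u1 u2 ->
  exists f1 g1 a1 a1' b1 b1' f2 g2 a2 a2' b2 b2',
    agrees u1 f1 f2 /\ agrees u2 g1 g2 /\
    core_data f1 g1 a1 a1' b1 b1' /\ core_data f2 g2 a2 a2' b2 b2'.
Proof.
intros [(C1 & z & dz & ddz) (C2 & w)].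
destruct (Ck01_extend 3 u1 C1) as (f1 & f2 & (f1' & D1 & f1'' & D1' & K1) &
  (f2' & D2 & f2'' & D2' & K2) & E).
destruct (Ck01_extend 3 u2 C2) as (g1 & g2 & (g1' & D3 & K3) & (g2' & D4 & K4) & F).
pose proof (agrees_D01 _ _ _ _ _ E D1 D2) as E1.
pose proof (agrees_D01 _ _ _ _ _ E1 D1' D2') as E2.
destruct (agrees_at _ _ _ _ E I01_0) as [X1 X2]; rewrite z in X1, X2.
destruct (agrees_at _ _ _ _ E1 I01_0) as [X3 X4]; rewrite dz in X3, X4.
destruct (agrees_at _ _ _ _ E2 I01_0) as [X5 X6]; rewrite ddz in X5, X6.
destruct (agrees_at _ _ _ _ F I01_0) as [X7 X8]; rewrite w in X7, X8.
simpl in *.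
destruct (core_data_intro f1 g1 f1' f1'' g1') as (a1 & a1' & b1 & b1' & Q1); trivial.
destruct (core_data_intro f2 g2 f2' f2'' g2') as (a2 & a2' & b2 & b2' & Q2); trivial.
exists f1, g1, a1, a1', b1, b1', f2, g2, a2, a2', b2, b2'; tauto.
Qed.

Section CoreProfiles.

Context {u1 u2 : R -> C} {f1 g1 a1 a1' b1 b1' f2 g2 a2 a2' b2 b2' : R -> R}.
Hypotheses (Eu1 : agrees u1 f1 f2) (Eu2 : agrees u2 g1 g2).
Hypotheses (K1 : core_data f1 g1 a1 a1' b1 b1') (K2 : core_data f2 g2 a2 a2' b2 b2').

Lemma core_profile1 : profile1 u1 a1 a2.
Proof.
apply (profile1_intro u1 f1 f2); try exact Eu1; try apply K1; try apply K2.
- apply (Ckr_S_intro 1 _ (fun x => x * a1 x)); [apply K1 | apply Ckr_pred, K1].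
- apply (Ckr_S_intro 1 _ (fun x => x * a2 x)); [apply K2 | apply Ckr_pred, K2].
- exact (core_a_C0 K1).
- exact (core_a_C0 K2).
Qed.

Lemma core_profile2 : profile2 u2 b1 b2.
Proof.
apply (profile2_intro u2 g1 g2); try exact Eu2; try apply K1; try apply K2.
- exact (core_b_C0 K1).
- exact (core_b_C0 K2).
Qed.

(** Differentiating -x f' + f + x g' - g with f' = x a and g' = b, the terms in b cancel and a
    factor x splits off, as [profile1] requires. *)
Lemma core_tL0_profile1 : profile1 (tL0_1 u1 u2)
  (fun x => b1' x - a1 x - x * a1' x) (fun x => b2' x - a2 x - x * a2' x).
Proof.
pose proof (agrees_D01 _ _ _ _ _ Eu1 (core_f _ _ _ _ _ _ K1) (core_f _ _ _ _ _ _ K2)) as E1.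
pose proof (agrees_D01 _ _ _ _ _ Eu2 (core_g _ _ _ _ _ _ K1) (core_g _ _ _ _ _ _ K2)) as E2.
assert (Reg : forall f g a a' b b', core_data f g a a' b b' ->
  Ckr 2 (fun x => - x * (x * a x) + f x + x * b x - g x)).
{ intros f g a a' b b' K; pose proof (core_g_C2 K); destruct K as [F0 G0 A0 Df Dg Da Db Cxa Cb Ca' Cb'].
  assert (Ckr 2 f)
    by (apply (Ckr_S_intro 1 _ (fun x => x * a x)); [|apply Ckr_pred]; assumption).
  Ckr_tac. }
assert (Der : forall f g a a' b b', core_data f g a a' b b' -> forall x, -1 < x ->
  is_derive (fun x => - x * (x * a x) + f x + x * b x - g x) x
    (x * (b' x - a x - x * a' x))).
{ intros f g a a' b b' [F0 G0 A0 Df Dg Da Db Cxa Cb Ca' Cb'] x Hx.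
  specialize (Df x Hx); specialize (Dg x Hx).
  specialize (Da x Hx); specialize (Db x Hx).
  auto_derive; [repeat split; trivial; eexists; eassumption|].
  derive_at Df; derive_at Dg; derive_at Da; derive_at Db; ring. }
assert (Z : forall f g a a' b b', core_data f g a a' b b' ->
  - 0 * (0 * a 0) + f 0 + 0 * b 0 - g 0 = 0).
{ intros f g a a' b b' [-> -> _ _ _ _ _ _ _ _ _]; ring. }
assert (Cont : forall f g a a' b b', core_data f g a a' b b' ->
  Ckr 0 (fun x => b' x - a x - x * a' x)).
{ intros f g a a' b b' K; pose proof (core_a_C0 K); destruct K as [F0 G0 A0 Df Dg Da Db Cxa Cb Ca' Cb']; Ckr_tac. }
apply (profile1_intro _ (fun x => - x * (x * a1 x) + f1 x + x * b1 x - g1 x)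
  (fun x => - x * (x * a2 x) + f2 x + x * b2 x - g2 x)); eauto.
intros x Ix; unfold tL0_1; rewrite Eu1, Eu2, E1, E2 by exact Ix.
apply injective_projections; simpl; ring.
Qed.

Lemma core_tL0_agrees :
  agrees (tL0_2 u1 u2) (fun x => a1 x - x * b1 x) (fun x => a2 x - x * b2 x).
Proof.
pose proof (agrees_D01 _ _ _ _ _ Eu1 (core_f _ _ _ _ _ _ K1) (core_f _ _ _ _ _ _ K2)) as E1.
pose proof (agrees_D01 _ _ _ _ _ Eu2 (core_g _ _ _ _ _ _ K1) (core_g _ _ _ _ _ _ K2)) as E2.
intros x Ix; unfold tL0_2; rewrite E1, E2 by exact Ix.
(* At 0 the formula of [tL0_2] gives 0 because the derivative of [u1] vanishes there; this matches
   the continuous representative since a(0) = 0. *)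
destruct (Req_EM_T x 0) as [->|N].
- rewrite (core_a0 _ _ _ _ _ _ K1), (core_a0 _ _ _ _ _ _ K2).
  apply injective_projections; simpl; ring.
- apply injective_projections; simpl; field; exact N.
Qed.

Lemma core_tL0_profile2 : profile2 (tL0_2 u1 u2)
  (fun x => a1' x - b1 x - x * b1' x) (fun x => a2' x - b2 x - x * b2' x).
Proof.
assert (Der : forall f g a a' b b', core_data f g a a' b b' -> forall x, -1 < x ->
  is_derive (fun x => a x - x * b x) x (a' x - b x - x * b' x)).
{ intros f g a a' b b' [F0 G0 A0 Df Dg Da Db Cxa Cb Ca' Cb'] x Hx.
  specialize (Da x Hx); specialize (Db x Hx).
  auto_derive; [repeat split; trivial; eexists; eassumption|].
  derive_at Da; derive_at Db; ring. }
assert (Cont : forall f g a a' b b', core_data f g a a' b b' ->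
  Ckr 0 (fun x => a' x - b x - x * b' x)).
{ intros f g a a' b b' K; pose proof (core_b_C0 K); destruct K as [F0 G0 A0 Df Dg Da Db Cxa Cb Ca' Cb']; Ckr_tac. }
apply (profile2_intro _ _ _ _ _ core_tL0_agrees); eauto.
- rewrite (core_a0 _ _ _ _ _ _ K1); ring.
- rewrite (core_a0 _ _ _ _ _ _ K2); ring.
Qed.

End CoreProfiles.

Lemma RInt_Ckr_plus f g : Ckr 0 f -> Ckr 0 g ->
  RInt (fun x => f x + g x) 0 1 = RInt f 0 1 + RInt g 0 1 :> R.
Proof.
intros Cf Cg; apply (RInt_plus (V := R_CompleteNormedModule) f g);
  apply continuous_ex_RInt; first [lra | assumption].
Qed.

Lemma RInt_Ckr_scal c f : Ckr 0 f ->
  RInt (fun x => c * f x) 0 1 = c * RInt f 0 1 :> R.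
Proof.
intros Cf; apply (RInt_scal (V := R_CompleteNormedModule) f).
apply continuous_ex_RInt; first [lra | assumption].
Qed.

Lemma RInt_Ckr_le f g : Ckr 0 f -> Ckr 0 g -> (forall x, I01 x -> f x <= g x) ->
  RInt f 0 1 <= RInt g 0 1.
Proof.
intros Cf Cg Hle; apply RInt_le; [lra | | |].
- apply continuous_ex_RInt; first [lra | assumption].
- apply continuous_ex_RInt; first [lra | assumption].
- intros x Hx; apply Hle; unfold I01; lra.
Qed.

(* Expand the integral over [0,x] of [(g' - g(x))^2 >= 0]. *)
Lemma sqr_le_energy g b x : Ckr 0 b -> g 0 = 0 ->
  (forall x, -1 < x -> is_derive g x (b x)) -> I01 x ->
  g x ^ 2 <= RInt (fun x => b x ^ 2) 0 1.
Proof.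
intros Cb g0 Dg [Hx0 Hx1].
assert (Cb2 : Ckr 0 (fun x => b x ^ 2)) by Ckr_tac.
destruct (Ckr_primitive _ 0 Cb2) as (P & P0 & DP).
rewrite (FTC _ P) by (lra || assumption).
set (c := g x).
assert (Q1 : 0 <= RInt (fun y => b y ^ 2) x 1).
{ apply RInt_ge_0; [lra | apply continuous_ex_RInt; lra || assumption |].
  intros; apply pow2_ge_0. }
assert (Q2 : 0 <= RInt (fun y => (b y - c) ^ 2) 0 x).
{ apply RInt_ge_0; [lra | apply continuous_ex_RInt; try lra; Ckr_tac |].
  intros; apply pow2_ge_0. }
rewrite (FTC _ P) in Q1 by (lra || assumption).
rewrite (FTC _ (fun y => P y - 2 * c * g y + c ^ 2 * y)) in Q2;
  [ | lra | lra | Ckr_tac |].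
- rewrite P0, g0 in Q2; fold c in Q2; rewrite P0.
  pose proof (pow2_ge_0 c); nra.
- intros y Hy; specialize (DP y Hy); specialize (Dg y Hy).
  auto_derive; [repeat split; trivial; eexists; eassumption|].
  derive_at DP; derive_at Dg; ring.
Qed.

(** * The perturbation in terms of profiles *)

Section Perturbation.

Context {g b : R -> R} (Cg : Ckr 1 g).
Context {W : R -> R} (W0 : W 0 = 0).
Hypothesis DW : forall x, -1 < x -> is_derive W x (x * g x).

(** The derivative of -V1 W divided by x, when W' = x g; differentiating V1 also produces a factor
    x. *)
Definition tL'_profile (g W : R -> R) (x : R) : R :=
  16 * / (1 + x ^ 2) ^ 2 * g x - 64 * / (1 + x ^ 2) ^ 3 * W x.

Lemma Ckr_inv_1p2 k n : Ckr k (fun x => / (1 + x ^ 2) ^ n).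
Proof.
apply Ckr_inv.
- intros x _; apply pow_nonzero; nra.
- induction n as [|n IHn]; [exact (Ckr_const k 1)|].
  apply (Ckr_mult k (fun x => 1 + x ^ 2)); [|exact IHn].
  apply Ckr_plus; [apply Ckr_const | apply (Ckr_sqr k (fun x => x)), Ckr_id].
Qed.

Lemma primitive_C2 : Ckr 2 W.
Proof.
apply (Ckr_S_intro 1 W (fun x => x * g x)); [exact DW | Ckr_tac].
Qed.

Lemma tL'_profile_C0 : Ckr 0 (tL'_profile g W).
Proof.
pose proof (Ckr_inv_1p2 0 2); pose proof (Ckr_inv_1p2 0 3).
pose proof (Ckr_pred 0 _ Cg); pose proof (Ckr_le 0 2 W ltac:(lia) primitive_C2).
unfold tL'_profile; Ckr_tac.
Qed.

Lemma tL'_derive x : -1 < x ->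
  is_derive (fun x => - V1 x * W x) x (x * tL'_profile g W x).
Proof.
intros Hx; specialize (DW x Hx); unfold V1, tL'_profile.
assert (P : 1 + x * (x * 1) <> 0) by nra.
auto_derive.
- repeat split; trivial; [|eexists; eassumption].
  simpl; rewrite Rmult_1_r; apply Rmult_integral_contrapositive; split; nra.
- derive_at DW; field; nra.
Qed.

(** The bound involves g and not g': this is what later turns into a gain of 1 / |l|. The primitive
    W is bounded pointwise by the L^2 norm of x g. *)
Lemma tL'_profile_bound :
  RInt (fun x => tL'_profile g W x ^ 2) 0 1 <= 8704 * RInt (fun x => g x ^ 2) 0 1.
Proof.
pose proof (Ckr_pred 0 _ Cg) as Cg0.
assert (Cxg : Ckr 0 (fun x => x * g x)) by Ckr_tac.
assert (Cg2 : Ckr 0 (fun x => g x ^ 2)) by Ckr_tac.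
set (J := RInt (fun x => g x ^ 2) 0 1).
assert (HW : forall x, I01 x -> W x ^ 2 <= J).
{ intros x Ix; eapply Rle_trans; [apply (sqr_le_energy W (fun x => x * g x)); eassumption|].
  apply RInt_Ckr_le; [Ckr_tac | exact Cg2|]; intros y [Y0 Y1].
  rewrite Rpow_mult_distr; pose proof (pow2_ge_0 (g y)).
  assert (y ^ 2 <= 1) by nra; nra. }
(* The squared sum of two terms costs a factor 2, so 8704 = 2 * 16^2 + 2 * 64^2, both powers of 1 /
   (1 + x^2) being at most 1. *)
assert (J0 : 8704 * J = RInt (fun x => 512 * g x ^ 2 + 8192 * J) 0 1 :> R).
{ rewrite RInt_Ckr_plus, RInt_Ckr_scal, RInt_const by Ckr_tac.
  change (8704 * J = 512 * J + (1 - 0) * (8192 * J)); ring. }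
rewrite J0; apply RInt_Ckr_le.
- apply Ckr_sqr, tL'_profile_C0.
- Ckr_tac.
- intros x Ix; specialize (HW x Ix); unfold tL'_profile.
  assert (B1 : 1 <= 1 + x ^ 2) by (pose proof (pow2_ge_0 x); lra).
  assert (Q : forall n, 0 < / (1 + x ^ 2) ^ n <= 1).
  { intros n; pose proof (pow_R1_Rle _ n B1); split.
    - apply Rinv_0_lt_compat; lra.
    - apply Rle_trans with (/ 1); [apply Rinv_le_contravar; lra | rewrite Rinv_1; lra]. }
  pose proof (Q 2%nat) as Q2; pose proof (Q 3%nat) as Q3.
  set (p := / (1 + x ^ 2) ^ 2) in *; set (q := / (1 + x ^ 2) ^ 3) in *.
  assert (p ^ 2 <= 1) by nra; assert (q ^ 2 <= 1) by nra.
  pose proof (pow2_ge_0 (g x)); pose proof (pow2_ge_0 (W x)).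
  assert (p ^ 2 * g x ^ 2 <= g x ^ 2) by nra.
  assert (q ^ 2 * W x ^ 2 <= W x ^ 2) by nra.
  pose proof (pow2_ge_0 (16 * p * g x + 64 * q * W x)); nra.
Qed.

End Perturbation.

(** * Linearity, dissipativity and smallness on the core *)

Section CoreOperator.

Context {H1 H2 : Hilbert} {j1 : (R -> C) -> H1} {j2 : (R -> C) -> H2}.
Hypothesis hH1 : is_completion tH1 ip1 H1 j1.
Hypothesis hH2 : is_completion tH2 ip2 H2 j2.

Lemma RInt_zero_sqr (f g : R -> R) : (forall x, I01 x -> f x = 0 /\ g x = 0) ->
  RInt (fun x => f x ^ 2 + g x ^ 2) 0 1 = 0 :> R.
Proof.
intros Z; transitivity (RInt (fun _ => 0) 0 1 : R).
- apply RInt_ext; rewrite Rmin_left, Rmax_right by lra; intros x Hx.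
  destruct (Z x ltac:(unfold I01; lra)) as [-> ->]; simpl; ring.
- rewrite RInt_const; unfold scal; simpl; unfold mult; simpl; ring.
Qed.

(** Needed because [tL0_1] of a sum and the sum of the values of [tL0_1] are only known to agree on
    [0,1], not as functions on R. *)
Lemma j1_ext u v a b c d : profile1 u a b -> profile1 v c d ->
  (forall x, I01 x -> a x = c x /\ b x = d x) -> j1 u = j1 v.
Proof.
intros P Q E; apply norm_minus_zero.
pose proof (norm_minus_profile1 hH1 _ _ _ _ _ _ P Q) as N.
rewrite (RInt_zero_sqr (fun x => a x - c x) (fun x => b x - d x)) in N; [nra|].
intros x Ix; destruct (E x Ix); lra.
Qed.

Lemma j2_ext u v a b c d : profile2 u a b -> profile2 v c d ->
  (forall x, I01 x -> a x = c x /\ b x = d x) -> j2 u = j2 v.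
Proof.
intros P Q E; apply norm_minus_zero.
pose proof (norm_minus_profile2 hH2 _ _ _ _ _ _ P Q) as N.
rewrite (RInt_zero_sqr (fun x => a x - c x) (fun x => b x - d x)) in N; [nra|].
intros x Ix; destruct (E x Ix); lra.
Qed.

Lemma prod_norm_sqr (x : H1) (y : H2) :
  norm ((x, y) : prod_Hilbert H1 H2) ^ 2 = norm x ^ 2 + norm y ^ 2.
Proof.
rewrite <- (rdot_norm (H := prod_Hilbert H1 H2)), <- !rdot_norm; reflexivity.
Qed.

Lemma tL0_plus u v u' v' : tL0 j1 j2 u v -> tL0 j1 j2 u' v' ->
  tL0 j1 j2 (hplus u u') (hplus v v').
Proof.
intros (u1 & u2 & Du & -> & ->) (w1 & w2 & Dw & -> & ->).
destruct (dom_core _ _ Du) as (f1 & g1 & a1 & a1' & b1 & b1' & f2 & g2 & a2 & a2' &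
  b2 & b2' & E1 & E2 & K1 & K2).
destruct (dom_core _ _ Dw) as (h1 & k1 & c1 & c1' & d1 & d1' & h2 & k2 & c2 & c2' &
  d2 & d2' & F1 & F2 & L1 & L2).
pose proof (core_data_lin 1 1 _ _ _ _ _ _ _ _ _ _ _ _ K1 L1) as M1.
pose proof (core_data_lin 1 1 _ _ _ _ _ _ _ _ _ _ _ _ K2 L2) as M2.
assert (G1 : agrees (fun r => u1 r + w1 r)%C (fun x => 1 * f1 x + 1 * h1 x)
  (fun x => 1 * f2 x + 1 * h2 x)).
{ intros x Ix; rewrite E1, F1 by exact Ix; apply injective_projections; simpl; ring. }
assert (G2 : agrees (fun r => u2 r + w2 r)%C (fun x => 1 * g1 x + 1 * k1 x)
  (fun x => 1 * g2 x + 1 * k2 x)).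
{ intros x Ix; rewrite E2, F2 by exact Ix; apply injective_projections; simpl; ring. }
exists (fun r => u1 r + w1 r)%C, (fun r => u2 r + w2 r)%C.
split; [exact (core_dom _ _ _ _ _ _ _ _ _ _ _ _ _ _ G1 G2 M1 M2)|].
pose proof (core_profile1 E1 K1 K2) as P1; pose proof (core_profile1 F1 L1 L2) as P2.
pose proof (core_profile2 E2 K1 K2) as P3; pose proof (core_profile2 F2 L1 L2) as P4.
pose proof (core_tL0_profile1 E1 E2 K1 K2) as Q1; pose proof (core_tL0_profile1 F1 F2 L1 L2) as Q2.
pose proof (core_tL0_profile2 E1 E2 K1 K2) as Q3; pose proof (core_tL0_profile2 F1 F2 L1 L2) as Q4.
split; apply injective_projections.
- symmetry; exact (completion_plus _ _ _ _ hH1 _ _ (proj1 P1) (proj1 P2)).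
- symmetry; exact (completion_plus _ _ _ _ hH2 _ _ (proj1 P3) (proj1 P4)).
- etransitivity; [symmetry; exact (completion_plus _ _ _ _ hH1 _ _ (proj1 Q1) (proj1 Q2))|].
  apply (j1_ext _ _ _ _ _ _ (profile1_plus _ _ _ _ _ _ Q1 Q2) (core_tL0_profile1 G1 G2 M1 M2)).
  intros; split; ring.
- etransitivity; [symmetry; exact (completion_plus _ _ _ _ hH2 _ _ (proj1 Q3) (proj1 Q4))|].
  apply (j2_ext _ _ _ _ _ _ (profile2_plus _ _ _ _ _ _ Q3 Q4) (core_tL0_profile2 G1 G2 M1 M2)).
  intros; split; ring.
Qed.

Lemma tL0_scal (z : C) u v : tL0 j1 j2 u v -> tL0 j1 j2 (hscal z u) (hscal z v).
Proof.
intros (u1 & u2 & Du & -> & ->).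
destruct (dom_core _ _ Du) as (f1 & g1 & a1 & a1' & b1 & b1' & f2 & g2 & a2 & a2' &
  b2 & b2' & E1 & E2 & K1 & K2).
pose proof (core_data_lin (Re z) (- Im z) _ _ _ _ _ _ _ _ _ _ _ _ K1 K2) as M1.
pose proof (core_data_lin (Re z) (Im z) _ _ _ _ _ _ _ _ _ _ _ _ K2 K1) as M2.
assert (G1 : agrees (fun r => z * u1 r)%C (fun x => Re z * f1 x + - Im z * f2 x)
  (fun x => Re z * f2 x + Im z * f1 x)).
{ intros x Ix; rewrite E1 by exact Ix; apply injective_projections; simpl;
    unfold Re, Im; ring. }
assert (G2 : agrees (fun r => z * u2 r)%C (fun x => Re z * g1 x + - Im z * g2 x)
  (fun x => Re z * g2 x + Im z * g1 x)).
{ intros x Ix; rewrite E2 by exact Ix; apply injective_projections; simpl;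
    unfold Re, Im; ring. }
exists (fun r => z * u1 r)%C, (fun r => z * u2 r)%C.
split; [exact (core_dom _ _ _ _ _ _ _ _ _ _ _ _ _ _ G1 G2 M1 M2)|].
pose proof (core_profile1 E1 K1 K2) as P1; pose proof (core_profile2 E2 K1 K2) as P3.
pose proof (core_tL0_profile1 E1 E2 K1 K2) as Q1; pose proof (core_tL0_profile2 E1 E2 K1 K2) as Q3.
split; apply injective_projections.
- symmetry; exact (completion_scal _ _ _ _ hH1 z _ (proj1 P1)).
- symmetry; exact (completion_scal _ _ _ _ hH2 z _ (proj1 P3)).
- etransitivity; [symmetry; exact (completion_scal _ _ _ _ hH1 z _ (proj1 Q1))|].
  apply (j1_ext _ _ _ _ _ _ (profile1_scal z _ _ _ Q1) (core_tL0_profile1 G1 G2 M1 M2)).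
  intros; split; ring.
- etransitivity; [symmetry; exact (completion_scal _ _ _ _ hH2 z _ (proj1 Q3))|].
  apply (j2_ext _ _ _ _ _ _ (profile2_scal z _ _ _ Q3) (core_tL0_profile2 G1 G2 M1 M2)).
  intros; split; ring.
Qed.

(** The coefficients of L0 are real, so the real part of the inner product splits into the same
    quadratic form for real and imaginary parts, and [core_dissipative] applies to each. *)
Lemma tL0_dissipative u v : tL0 j1 j2 u v -> rdot v u <= - (1 / 2) * norm u ^ 2.
Proof.
intros (u1 & u2 & Du & -> & ->).
destruct (dom_core _ _ Du) as (f1 & g1 & a1 & a1' & b1 & b1' & f2 & g2 & a2 & a2' &
  b2 & b2' & E1 & E2 & K1 & K2).
pose proof (core_profile1 E1 K1 K2) as P1; pose proof (core_profile2 E2 K1 K2) as P3.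
pose proof (core_tL0_profile1 E1 E2 K1 K2) as Q1; pose proof (core_tL0_profile2 E1 E2 K1 K2) as Q3.
rewrite prod_norm_sqr, (norm_profile1 hH1 _ _ _ P1), (norm_profile2 hH2 _ _ _ P3).
change (rdot (j1 (tL0_1 u1 u2)) (j1 u1) + rdot (j2 (tL0_2 u1 u2)) (j2 u2) <=
  - (1 / 2) * (RInt (fun x => a1 x ^ 2 + a2 x ^ 2) 0 1 +
    RInt (fun x => b1 x ^ 2 + b2 x ^ 2) 0 1)).
rewrite (rdot_profile1 hH1 _ _ _ _ _ _ Q1 P1), (rdot_profile2 hH2 _ _ _ _ _ _ Q3 P3).
pose proof (core_dissipative K1) as D1; pose proof (core_dissipative K2) as D2.
pose proof (core_a_C0 K1); pose proof (core_a_C0 K2).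
pose proof (core_b_C0 K1); pose proof (core_b_C0 K2).
pose proof (core_a'_C0 _ _ _ _ _ _ K1); pose proof (core_a'_C0 _ _ _ _ _ _ K2).
pose proof (core_b'_C0 _ _ _ _ _ _ K1); pose proof (core_b'_C0 _ _ _ _ _ _ K2).
rewrite !RInt_Ckr_plus in * by Ckr_tac.
lra.
Qed.

Lemma core_tL'_profile1 u1 u2 f1 g1 a1 a1' b1 b1' f2 g2 a2 a2' b2 b2' :
  agrees u1 f1 f2 -> agrees u2 g1 g2 ->
  core_data f1 g1 a1 a1' b1 b1' -> core_data f2 g2 a2 a2' b2 b2' ->
  exists k1 k2, profile1 (tL'_1 u2) k1 k2 /\
    RInt (fun x => k1 x ^ 2 + k2 x ^ 2) 0 1 <=
      8704 * RInt (fun x => g1 x ^ 2 + g2 x ^ 2) 0 1.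
Proof.
intros E1 E2 K1 K2.
pose proof (Ckr_pred _ _ (core_g_C2 K1)) as C1; pose proof (Ckr_pred _ _ (core_g_C2 K2)) as C2.
pose proof (Ckr_pred _ _ C1) as C10; pose proof (Ckr_pred _ _ C2) as C20.
assert (X1 : Ckr 0 (fun x => x * g1 x)) by Ckr_tac.
assert (X2 : Ckr 0 (fun x => x * g2 x)) by Ckr_tac.
destruct (Ckr_primitive _ 0 X1) as (W1 & W10 & D1).
destruct (Ckr_primitive _ 0 X2) as (W2 & W20 & D2).
assert (CV : Ckr 2 (fun x => - V1 x)).
{ pose proof (Ckr_inv_1p2 2 2).
  apply Ckr_ext with (fun x => 16 * / (1 + x ^ 2) ^ 2); [|Ckr_tac].
  intros x _; unfold V1, Rdiv; ring. }
pose proof (primitive_C2 C1 D1) as CW1; pose proof (primitive_C2 C2 D2) as CW2.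
exists (tL'_profile g1 W1), (tL'_profile g2 W2); split.
- apply (profile1_intro _ (fun x => - V1 x * W1 x) (fun x => - V1 x * W2 x)); try solve [Ckr_tac].
  + intros x Ix; unfold tL'_1.
    rewrite (CInt_pair _ (fun x => x * g1 x) (fun x => x * g2 x)); try assumption; try lra.
    * rewrite (FTC _ W1), (FTC _ W2), W10, W20; try assumption; try lra;
        try (apply I01_gt; exact Ix).
      apply injective_projections; simpl; ring.
    * apply Ix.
    * intros y Hy; assert (Iy : I01 y) by (unfold I01 in *; lra).
      rewrite E2 by exact Iy; apply injective_projections; simpl; ring.
  + rewrite W10; ring.
  + rewrite W20; ring.
  + exact (tL'_profile_C0 C1 D1).
  + exact (tL'_profile_C0 C2 D2).
  + intros x Hx; apply tL'_derive; assumption.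
  + intros x Hx; apply tL'_derive; assumption.
- pose proof (tL'_profile_C0 C1 D1); pose proof (tL'_profile_C0 C2 D2).
  rewrite !RInt_Ckr_plus by Ckr_tac.
  pose proof (tL'_profile_bound C1 W10 D1); pose proof (tL'_profile_bound C2 W20 D2); lra.
Qed.

(* The second component of [l u - L0 u = phi] reads
   [l u2 = phi2 + u1' / x - x u2'], so [|l|] times the L^2 norm of [u2] is
   controlled by the norms of [phi] and [u]; this is the gain of [1 / |l|]. *)
Lemma tL'_small L' (hL' : is_L' j1 j2 L') (l : C) u v : tL0 j1 j2 u v ->
  Cmod l ^ 2 * norm (L' u) ^ 2 <=
    26112 * (norm (hminus (hscal l u) v) ^ 2 + norm u ^ 2).
Proof.
intros (u1 & u2 & Du & -> & ->).
destruct (dom_core _ _ Du) as (f1 & g1 & a1 & a1' & b1 & b1' & f2 & g2 & a2 & a2' &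
  b2 & b2' & E1 & E2 & K1 & K2).
pose proof (core_profile1 E1 K1 K2) as P1; pose proof (core_profile2 E2 K1 K2) as P2.
pose proof (core_tL0_profile2 E1 E2 K1 K2) as Q2.
destruct (core_tL'_profile1 _ _ _ _ _ _ _ _ _ _ _ _ _ _ E1 E2 K1 K2) as (k1 & k2 & P3 & Bd).
rewrite (proj2 hL' u1 u2 (proj1 P1) (proj1 P2)).
rewrite prod_norm_sqr, (norm_profile1 hH1 _ _ _ P3).
replace (norm (zero : H2)) with 0 by (symmetry; exact norm_zero).
assert (N : norm (hminus (hscal l (j2 u2)) (j2 (tL0_2 u1 u2))) ^ 2 <=
  norm (hminus (hscal l ((j1 u1, j2 u2) : prod_Hilbert H1 H2))
    (j1 (tL0_1 u1 u2), j2 (tL0_2 u1 u2))) ^ 2).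
{ change (norm (hminus (hscal l (j2 u2)) (j2 (tL0_2 u1 u2))) ^ 2 <=
    norm ((hminus (hscal l (j1 u1)) (j1 (tL0_1 u1 u2)),
      hminus (hscal l (j2 u2)) (j2 (tL0_2 u1 u2))) : prod_Hilbert H1 H2) ^ 2).
  rewrite prod_norm_sqr.
  pose proof (pow2_ge_0 (norm (hminus (hscal l (j1 u1)) (j1 (tL0_1 u1 u2))))); lra. }
rewrite <- (completion_scal _ _ _ _ hH2) in N by apply P2.
pose proof (profile2_scal l _ _ _ P2) as P4.
rewrite (norm_minus_profile2 hH2 _ _ _ _ _ _ P4 Q2) in N.
rewrite (prod_norm_sqr (j1 u1)), (norm_profile1 hH1 _ _ _ P1), (norm_profile2 hH2 _ _ _ P2).
set (p := Re l) in *; set (q := Im l) in *.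
set (B1 := fun x => p * b1 x - q * b2 x - (a1' x - b1 x - x * b1' x)).
set (B2 := fun x => p * b2 x + q * b1 x - (a2' x - b2 x - x * b2' x)).
pose proof (core_a_C0 K1); pose proof (core_a_C0 K2).
pose proof (core_b_C0 K1); pose proof (core_b_C0 K2).
pose proof (core_a'_C0 _ _ _ _ _ _ K1); pose proof (core_a'_C0 _ _ _ _ _ _ K2).
pose proof (core_b'_C0 _ _ _ _ _ _ K1); pose proof (core_b'_C0 _ _ _ _ _ _ K2).
pose proof (Ckr_le 0 2 g1 ltac:(lia) (core_g_C2 K1)).
pose proof (Ckr_le 0 2 g2 ltac:(lia) (core_g_C2 K2)).
assert (CB1 : Ckr 0 B1) by (unfold B1; Ckr_tac).
assert (CB2 : Ckr 0 B2) by (unfold B2; Ckr_tac).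
(* The function squared is the real part of phi2 = l u2 - (a - x b). It vanishes at 0 because g and
   a do, so [sqr_le_energy] bounds it pointwise by its energy, a part of |phi|^2. *)
assert (Phi1 : forall x, I01 x ->
  (p * g1 x - q * g2 x - (a1 x - x * b1 x)) ^ 2 <= RInt (fun x => B1 x ^ 2) 0 1).
{ intros x Ix.
  apply (sqr_le_energy (fun x => p * g1 x - q * g2 x - (a1 x - x * b1 x))); try assumption.
  - destruct K1 as [_ -> -> _ _ _ _ _ _ _ _], K2 as [_ -> _ _ _ _ _ _ _ _ _]; ring.
  - clear x Ix; intros x Hx.
    pose proof (core_g _ _ _ _ _ _ K1 x Hx) as D1; pose proof (core_g _ _ _ _ _ _ K2 x Hx) as D2.
    pose proof (core_a _ _ _ _ _ _ K1 x Hx) as D3; pose proof (core_b _ _ _ _ _ _ K1 x Hx) as D4.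
    auto_derive; [repeat split; trivial; eexists; eassumption|].
    derive_at D1; derive_at D2; derive_at D3; derive_at D4; unfold B1; ring. }
assert (Phi2 : forall x, I01 x ->
  (p * g2 x + q * g1 x - (a2 x - x * b2 x)) ^ 2 <= RInt (fun x => B2 x ^ 2) 0 1).
{ intros x Ix.
  apply (sqr_le_energy (fun x => p * g2 x + q * g1 x - (a2 x - x * b2 x))); try assumption.
  - destruct K2 as [_ -> -> _ _ _ _ _ _ _ _], K1 as [_ -> _ _ _ _ _ _ _ _ _]; ring.
  - clear x Ix; intros x Hx.
    pose proof (core_g _ _ _ _ _ _ K2 x Hx) as D1; pose proof (core_g _ _ _ _ _ _ K1 x Hx) as D2.
    pose proof (core_a _ _ _ _ _ _ K2 x Hx) as D3; pose proof (core_b _ _ _ _ _ _ K2 x Hx) as D4.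
    auto_derive; [repeat split; trivial; eexists; eassumption|].
    derive_at D1; derive_at D2; derive_at D3; derive_at D4; unfold B2; ring. }
change (RInt (fun x => B1 x ^ 2 + B2 x ^ 2) 0 1 <=
  norm (hminus (hscal l ((j1 u1, j2 u2) : prod_Hilbert H1 H2))
    (j1 (tL0_1 u1 u2), j2 (tL0_2 u1 u2))) ^ 2) in N.
set (NF := norm (hminus (hscal l ((j1 u1, j2 u2) : prod_Hilbert H1 H2))
    (j1 (tL0_1 u1 u2), j2 (tL0_2 u1 u2))) ^ 2) in *.
set (J1 := RInt (fun x => B1 x ^ 2) 0 1) in *.
set (J2 := RInt (fun x => B2 x ^ 2) 0 1) in *.
assert (ML : Cmod l ^ 2 = p ^ 2 + q ^ 2).
{ apply RtoC_inj; rewrite Cmod2_conj; unfold p, q; destruct l.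
  apply injective_projections; simpl; ring. }
(* Solving for l u2 = phi2 + a - x b and squaring three terms costs a factor 3; together with 8704
   this gives 26112 = 3 * 8704. *)
assert (M : RInt (fun x => (p ^ 2 + q ^ 2) * (g1 x ^ 2 + g2 x ^ 2)) 0 1 <=
  RInt (fun x => 3 * (a1 x ^ 2 + a2 x ^ 2 + (b1 x ^ 2 + b2 x ^ 2)) + 3 * (J1 + J2)) 0 1).
{ apply RInt_Ckr_le; [Ckr_tac | Ckr_tac |].
  intros x Ix; specialize (Phi1 x Ix); specialize (Phi2 x Ix).
  set (s1 := p * g1 x - q * g2 x - (a1 x - x * b1 x)) in *.
  set (s2 := p * g2 x + q * g1 x - (a2 x - x * b2 x)) in *.
  replace ((p ^ 2 + q ^ 2) * (g1 x ^ 2 + g2 x ^ 2)) with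
    ((s1 + a1 x - x * b1 x) ^ 2 + (s2 + a2 x - x * b2 x) ^ 2) by (unfold s1, s2; ring).
  assert (T : forall r s t, (r + s - x * t) ^ 2 <= 3 * (r ^ 2 + s ^ 2 + t ^ 2)).
  { intros r s t; destruct Ix.
    assert ((x * t) ^ 2 <= t ^ 2).
    { rewrite Rpow_mult_distr; pose proof (pow2_ge_0 t).
      assert (x ^ 2 <= 1) by nra; nra. }
    pose proof (pow2_ge_0 (r - s)); pose proof (pow2_ge_0 (r + x * t));
      pose proof (pow2_ge_0 (s + x * t)); nra. }
  pose proof (T s1 (a1 x) (b1 x)); pose proof (T s2 (a2 x) (b2 x)); lra. }
rewrite (RInt_Ckr_scal (p ^ 2 + q ^ 2)) in M by Ckr_tac.
rewrite (RInt_Ckr_plus (fun x => 3 * (a1 x ^ 2 + a2 x ^ 2 + (b1 x ^ 2 + b2 x ^ 2)))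
  (fun _ => 3 * (J1 + J2))), (RInt_Ckr_scal 3),
  (RInt_Ckr_plus (fun x => a1 x ^ 2 + a2 x ^ 2) (fun x => b1 x ^ 2 + b2 x ^ 2)),
  RInt_const in M by Ckr_tac.
change (scal (1 - 0) (3 * (J1 + J2))) with ((1 - 0) * (3 * (J1 + J2))) in M.
rewrite RInt_Ckr_plus in N by Ckr_tac; fold J1 J2 in N.
rewrite ML.
pose proof (pow2_ge_0 p); pose proof (pow2_ge_0 q).
set (G := RInt (fun x => g1 x ^ 2 + g2 x ^ 2) 0 1) in *.
set (X := RInt (fun x => k1 x ^ 2 + k2 x ^ 2) 0 1) in *.
assert ((p ^ 2 + q ^ 2) * X <= (p ^ 2 + q ^ 2) * (8704 * G))
  by (apply Rmult_le_compat_l; lra).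
replace ((p ^ 2 + q ^ 2) * (X + 0 ^ 2)) with ((p ^ 2 + q ^ 2) * X) by ring.
lra.
Qed.

End CoreOperator.

(** * Polynomial approximation and density of the range *)

Fixpoint peval (c : R) (l : list R) (x : R) : R :=
  match l with
  | nil => 0
  | (k :: l')%list => k + (x - c) * peval c l' x
  end.

(** An expansion around every centre is demanded because the Euler equations are solved in powers of
    x - 1 and of x + 1. *)
Definition is_poly (P : R -> R) : Prop :=
  forall c, exists l, forall x, P x = peval c l x.

Lemma peval_plus c l1 l2 : exists l, forall x, peval c l x = peval c l1 x + peval c l2 x.
Proof.
revert l2; induction l1 as [|k1 l1 IH]; intros l2.
- exists l2; intros x; simpl; ring.
- destruct l2 as [|k2 l2].
  + exists (k1 :: l1)%list; intros x; simpl; ring.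
  + destruct (IH l2) as [l El]; exists ((k1 + k2) :: l)%list.
    intros x; simpl; rewrite El; ring.
Qed.

Lemma peval_scal c p l1 : exists l, forall x, peval c l x = p * peval c l1 x.
Proof.
induction l1 as [|k l1 [l El]].
- exists nil; intros x; simpl; ring.
- exists ((p * k) :: l)%list; intros x; simpl; rewrite El; ring.
Qed.

Lemma is_poly_plus P Q : is_poly P -> is_poly Q -> is_poly (fun x => P x + Q x).
Proof.
intros HP HQ c; destruct (HP c) as [l1 E1], (HQ c) as [l2 E2].
destruct (peval_plus c l1 l2) as [l El]; exists l; intros x.
rewrite El, E1, E2; reflexivity.
Qed.

Lemma is_poly_affine_mult p q P : is_poly P -> is_poly (fun x => (p + q * x) * P x).
Proof.
intros HP c; destruct (HP c) as [l1 E1].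
destruct (peval_scal c (p + q * c) l1) as [l2 E2], (peval_scal c q l1) as [l3 E3].
destruct (peval_plus c l2 (0 :: l3)%list) as [l El]; exists l; intros x.
rewrite El; simpl; rewrite E2, E3, E1; ring.
Qed.

Lemma is_poly_const k : is_poly (fun _ => k).
Proof. intros c; exists (k :: nil)%list; intros x; simpl; ring. Qed.

Lemma is_poly_ext P Q : (forall x, P x = Q x) -> is_poly P -> is_poly Q.
Proof. intros E HP c; destruct (HP c) as [l El]; exists l; intros x; rewrite <- E; apply El. Qed.

Lemma is_poly_minus P Q : is_poly P -> is_poly Q -> is_poly (fun x => P x - Q x).
Proof.
intros HP HQ; apply is_poly_ext with (fun x => P x + (-1 + 0 * x) * Q x); [intros; ring|].
apply is_poly_plus, is_poly_affine_mult; assumption.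
Qed.

Lemma Ckr_peval k c l : Ckr k (peval c l).
Proof.
induction l as [|p l IH]; [exact (Ckr_const k 0)|].
apply (Ckr_plus k (fun _ => p)); [apply Ckr_const|].
apply Ckr_mult; [apply Ckr_minus; [apply Ckr_id | apply Ckr_const] | exact IH].
Qed.

Lemma Ckr_poly k P : is_poly P -> Ckr k P.
Proof.
intros HP; destruct (HP 0) as [l El].
apply Ckr_ext with (peval 0 l); [intros; symmetry; apply El | apply Ckr_peval].
Qed.

(* Expectation of [g] under the binomial law with parameters [n] and [x], so
   that [fun x => bernstein n (fun k => f (k / n)) x] is the Bernstein
   polynomial of [f]. *)
Fixpoint bernstein (n : nat) (g : nat -> R) (x : R) : R :=
  match n with
  | O => g O
  | S n' => x * bernstein n' (fun k => g (S k)) x + (1 - x) * bernstein n' g x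
  end.

Lemma bernstein_poly n g : is_poly (bernstein n g).
Proof.
revert g; induction n as [|n IH]; intros g; [exact (is_poly_const (g O))|].
apply is_poly_ext with (fun x => (0 + 1 * x) * bernstein n (fun k => g (S k)) x +
  (1 + -1 * x) * bernstein n g x); [intros; simpl; ring|].
apply is_poly_plus; apply is_poly_affine_mult, IH.
Qed.

Lemma bernstein_ext n g h x : (forall k, g k = h k) -> bernstein n g x = bernstein n h x.
Proof.
revert g h; induction n as [|n IH]; intros g h E; simpl; [apply E|].
rewrite (IH g h E), (IH (fun k => g (S k)) (fun k => h (S k))); [reflexivity|].
intros; apply E.
Qed.

Lemma bernstein_affine n p q g x :
  bernstein n (fun k => p + q * g k) x = p + q * bernstein n g x.
Proof.
revert g; induction n as [|n IH]; intros g; simpl; [reflexivity|].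
rewrite (IH g), (IH (fun k => g (S k))); ring.
Qed.

Lemma bernstein_le n g h x : I01 x -> (forall k, (k <= n)%nat -> g k <= h k) ->
  bernstein n g x <= bernstein n h x.
Proof.
intros [X0 X1]; revert g h; induction n as [|n IH]; intros g h E; simpl; [apply E; lia|].
apply Rplus_le_compat; apply Rmult_le_compat_l; try lra; apply IH; intros; apply E; lia.
Qed.

(** Variance plus squared bias. The free shift t makes the induction work: a success in one trial
    replaces t by t - 1. *)
Lemma bernstein_variance n t x :
  bernstein n (fun k => (INR k - t) ^ 2) x = INR n * x * (1 - x) + (INR n * x - t) ^ 2.
Proof.
revert t; induction n as [|n IH]; intros t; [simpl; ring|].
cbn [bernstein]; rewrite IH.
rewrite (bernstein_ext n _ (fun k => (INR k - (t - 1)) ^ 2))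
  by (intros k; rewrite S_INR; ring).
rewrite IH, S_INR; ring.
Qed.

Lemma Ckr_continuity_pt f x : Ckr 0 f -> I01 x -> continuity_pt f x.
Proof. intros Cf Ix; apply continuity_pt_filterlim, Cf, I01_gt, Ix. Qed.

Lemma Ckr_bounded f : Ckr 0 f -> exists M, 0 < M /\ forall x, I01 x -> Rabs (f x) <= M.
Proof.
intros Cf.
destruct (continuity_ab_maj (fun x => Rabs (f x)) 0 1 ltac:(lra)) as (m & Hm & _).
- intros x Hx; apply (continuity_pt_comp f Rabs);
    [apply Ckr_continuity_pt; assumption | apply Rcontinuity_abs].
- exists (Rabs (f m) + 1); pose proof (Rabs_pos (f m)); split; [lra|].
  intros x Ix; pose proof (Hm x Ix); simpl in *; lra.
Qed.

Lemma weierstrass f e : Ckr 0 f -> 0 < e ->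
  exists P, is_poly P /\ forall x, I01 x -> Rabs (P x - f x) <= e.
Proof.
intros Cf He; destruct (Ckr_bounded f Cf) as (M & PM & HM).
assert (He2 : 0 < e / 2) by lra.
destruct (Heine_cor2 (f := f) (a := 0) (b := 1)
  (fun x Hx => Ckr_continuity_pt f x Cf Hx) (mkposreal _ He2)) as (d & Hd).
cbn [pos] in Hd; pose proof (cond_pos d) as Pd.
(* Where |y - x| >= d, uniform continuity says nothing, but |f y - f x| <= 2 M <= K (y - x)^2.
   Averaged over the binomial law this costs at most K / n, and n is taken so large that K / n <= e
   / 2. *)
set (K := 2 * M / d ^ 2).
assert (PK : 0 < K) by (apply Rdiv_lt_0_compat; [lra | apply pow_lt, Pd]).
destruct (nfloor_ex (2 * K / e)) as (n0 & _ & Hn); [apply Rlt_le, Rdiv_lt_0_compat; lra|].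
set (n := S n0); assert (En : INR n = INR n0 + 1) by apply S_INR.
pose proof (pos_INR n0) as P0.
assert (Nn : K / INR n <= e / 2).
{ rewrite <- En in Hn.
  apply Rmult_le_reg_r with (INR n * (2 / e)).
  - apply Rmult_lt_0_compat; [lra | apply Rdiv_lt_0_compat; lra].
  - replace (K / INR n * (INR n * (2 / e))) with (2 * K / e) by (field; lra).
    replace (e / 2 * (INR n * (2 / e))) with (INR n) by (field; lra); lra. }
exists (bernstein n (fun k => f (INR k / INR n))); split; [apply bernstein_poly|].
intros x Ix.
assert (Pt : forall k, (k <= n)%nat -> Rabs (f (INR k / INR n) - f x) <=
  e / 2 + K / INR n ^ 2 * (INR k - INR n * x) ^ 2).
{ intros k Hk; set (y := INR k / INR n).
  assert (Iy : I01 y).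
  { apply le_INR in Hk; pose proof (pos_INR k); unfold I01, y; split.
    - apply Rdiv_le_0_compat; lra.
    - apply Rmult_le_reg_r with (INR n); [lra|]; unfold Rdiv.
      rewrite Rmult_assoc, Rinv_l by lra; lra. }
  replace (K / INR n ^ 2 * (INR k - INR n * x) ^ 2) with (K * (y - x) ^ 2)
    by (unfold y; field; lra).
  pose proof (pow2_ge_0 (y - x)).
  destruct (Rlt_le_dec (Rabs (y - x)) d) as [L|L].
  - pose proof (Hd y x Iy Ix L); nra.
  - assert (d ^ 2 <= (y - x) ^ 2).
    { rewrite <- (pow2_abs (y - x)); apply pow_incr; lra. }
    assert (K * d ^ 2 = 2 * M) by (unfold K; field; lra).
    pose proof (Rabs_triang (f y) (- f x)); rewrite Rabs_Ropp in *.
    pose proof (HM y Iy); pose proof (HM x Ix); unfold Rminus at 1; nra. }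
assert (V : bernstein n (fun k => e / 2 + K / INR n ^ 2 * (INR k - INR n * x) ^ 2) x <= e).
{ rewrite bernstein_affine, bernstein_variance.
  replace (K / INR n ^ 2 * (INR n * x * (1 - x) + (INR n * x - INR n * x) ^ 2))
    with (K / INR n * (x * (1 - x))) by (field; lra).
  destruct Ix.
  assert (0 < K / INR n) by (apply Rdiv_lt_0_compat; lra).
  assert (0 <= x * (1 - x) <= 1) by nra; nra. }
assert (Ed : bernstein n (fun k => f (INR k / INR n)) x - f x =
  bernstein n (fun k => - f x + 1 * f (INR k / INR n)) x)
  by (rewrite bernstein_affine; ring).
rewrite Ed; apply Rabs_le; split.
- apply Rle_trans with
    (0 + -1 * bernstein n (fun k => e / 2 + K / INR n ^ 2 * (INR k - INR n * x) ^ 2) x); [lra|].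
  rewrite <- bernstein_affine; apply bernstein_le; [exact Ix|]; intros k Hk.
  pose proof (Pt k Hk); pose proof (Rabs_maj2 (f (INR k / INR n) - f x)); lra.
- eapply Rle_trans; [|exact V]; apply bernstein_le; [exact Ix|]; intros k Hk.
  pose proof (Pt k Hk); pose proof (Rle_abs (f (INR k / INR n) - f x)); lra.
Qed.

(* With [mu = m + i n], solves [mu p + (x - c) p' = P]: the coefficient of
   [(x - c)^j] is divided by [mu + j]. *)
Lemma euler_solve_real c l m n : 0 < m -> exists p q p' q' : R -> R,
  (forall k, Ckr k p) /\ (forall k, Ckr k q) /\
  (forall x, is_derive p x (p' x)) /\ (forall x, is_derive q x (q' x)) /\
  (forall x, m * p x - n * q x + (x - c) * p' x = peval c l x) /\
  (forall x, m * q x + n * p x + (x - c) * q' x = 0).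
Proof.
revert m; induction l as [|k l IH]; intros m Hm.
- exists (fun _ => 0), (fun _ => 0), (fun _ => 0), (fun _ => 0).
  split; [intros; apply Ckr_const|]; split; [intros; apply Ckr_const|].
  split; [intros x; apply (is_derive_const 0 x)|]; split; [intros x; apply (is_derive_const 0 x)|].
  split; intros x; simpl; ring.
- destruct (IH (m + 1) ltac:(lra)) as (p & q & p' & q' & Cp & Cq & Dp & Dq & E1 & E2).
  set (N := m ^ 2 + n ^ 2); assert (PN : 0 < N) by (unfold N; nra).
  exists (fun x => k * m / N + (x - c) * p x), (fun x => - (k * n / N) + (x - c) * q x),
    (fun x => p x + (x - c) * p' x), (fun x => q x + (x - c) * q' x).
  split; [intros j; specialize (Cp j); Ckr_tac|].
  split; [intros j; specialize (Cq j); Ckr_tac|].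
  assert (D : forall s (f f' : R -> R), (forall x, is_derive f x (f' x)) ->
    forall x : R, is_derive (fun x => s + (x - c) * f x) x (f x + (x - c) * f' x)).
  { intros s f f' Df x; specialize (Df x).
    auto_derive; [eexists; eassumption|]; derive_at Df; ring. }
  split; [apply D, Dp|]; split; [apply D, Dq|]; split; intros x; simpl.
  + rewrite <- (E1 x); unfold N in *; field; lra.
  + replace (m * (- (k * n / N) + (x - c) * q x) + n * (k * m / N + (x - c) * p x) +
      (x - c) * (q x + (x - c) * q' x)) with
      ((x - c) * ((m + 1) * q x + n * p x + (x - c) * q' x)) by (field; lra).
    rewrite (E2 x); ring.
Qed.

(** By linearity: the solution for P plus i times the solution for Q. *)
Lemma euler_solve c P Q m n : is_poly P -> is_poly Q -> 0 < m ->
  exists p q p' q' : R -> R,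
  (forall k, Ckr k p) /\ (forall k, Ckr k q) /\
  (forall x, is_derive p x (p' x)) /\ (forall x, is_derive q x (q' x)) /\
  (forall x, m * p x - n * q x + (x - c) * p' x = P x) /\
  (forall x, m * q x + n * p x + (x - c) * q' x = Q x).
Proof.
intros HP HQ Hm; destruct (HP c) as [l1 L1], (HQ c) as [l2 L2].
destruct (euler_solve_real c l1 m n Hm) as (p & q & p' & q' & Cp & Cq & Dp & Dq & E1 & E2).
destruct (euler_solve_real c l2 m n Hm) as (r & s & r' & s' & Cr & Cs & Dr & Ds & E3 & E4).
exists (fun x => p x - s x), (fun x => q x + r x),
  (fun x => p' x - s' x), (fun x => q' x + r' x).
split; [intros k; apply Ckr_minus; auto|].
split; [intros k; apply Ckr_plus; auto|].
split; [intros x; apply (is_derive_minus p s); auto|].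
split; [intros x; apply (is_derive_plus q r); auto|].
split; intros x.
- rewrite L1; specialize (E1 x); specialize (E4 x); lra.
- rewrite L2; specialize (E2 x); specialize (E3 x); lra.
Qed.

(** * Density of the core and of the range *)

Lemma core_data_of a a' b b' : a 0 = 0 -> Ckr 2 a -> Ckr 2 b ->
  (forall x, -1 < x -> is_derive a x (a' x)) ->
  (forall x, -1 < x -> is_derive b x (b' x)) ->
  exists f g, core_data f g a a' b b'.
Proof.
intros A0 Ca Cb Da Db.
assert (Cxa : Ckr 2 (fun x => x * a x)) by Ckr_tac.
destruct (Ckr_primitive _ 0 (Ckr_le 0 2 _ ltac:(lia) Cxa)) as (f & f0 & Df).
destruct (Ckr_primitive _ 0 (Ckr_le 0 2 _ ltac:(lia) Cb)) as (g & g0 & Dg).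
exists f, g; constructor; try assumption.
- apply (Ckr_pred 0), (Ckr_derive 1 a); assumption.
- apply (Ckr_pred 0), (Ckr_derive 1 b); assumption.
Qed.

Lemma core_realize a1 a1' b1 b1' a2 a2' b2 b2' :
  (exists f1 g1, core_data f1 g1 a1 a1' b1 b1') ->
  (exists f2 g2, core_data f2 g2 a2 a2' b2 b2') ->
  exists u1 u2, dom_tL0 u1 u2 /\ profile1 u1 a1 a2 /\ profile2 u2 b1 b2 /\
    profile1 (tL0_1 u1 u2)
      (fun x => b1' x - a1 x - x * a1' x) (fun x => b2' x - a2 x - x * a2' x) /\
    profile2 (tL0_2 u1 u2)
      (fun x => a1' x - b1 x - x * b1' x) (fun x => a2' x - b2 x - x * b2' x).
Proof.
intros (f1 & g1 & K1) (f2 & g2 & K2).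
assert (E1 : agrees (fun x => (f1 x, f2 x)) f1 f2) by (intros x _; reflexivity).
assert (E2 : agrees (fun x => (g1 x, g2 x)) g1 g2) by (intros x _; reflexivity).
exists (fun x => (f1 x, f2 x)), (fun x => (g1 x, g2 x)).
split; [exact (core_dom _ _ _ _ _ _ _ _ _ _ _ _ _ _ E1 E2 K1 K2)|].
split; [exact (core_profile1 E1 K1 K2)|].
split; [exact (core_profile2 E2 K1 K2)|].
split; [exact (core_tL0_profile1 E1 E2 K1 K2) | exact (core_tL0_profile2 E1 E2 K1 K2)].
Qed.

Lemma Ckr_exp k c : Ckr k (fun x => exp (c * x)).
Proof.
assert (D : forall x, -1 < x -> is_derive (fun x => exp (c * x)) x (c * exp (c * x)))
  by (intros x _; auto_derive; [trivial | ring]).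
induction k as [|k IH].
- intros x Hx; apply (ex_derive_continuous (fun x => exp (c * x))).
  eexists; apply D, Hx.
- apply (Ckr_S_intro k _ _ D); Ckr_tac.
Qed.

(* The approximant vanishes at 0: a polynomial is multiplied by
   [1 - exp (- K x)] with K large. *)
Lemma L2_approx_vanishing f e : Ckr 0 f -> 0 < e ->
  exists a, Ckr 3 a /\ a 0 = 0 /\ RInt (fun x => (a x - f x) ^ 2) 0 1 <= 3 * e ^ 2.
Proof.
intros Cf He; destruct (weierstrass f e Cf He) as (P & HP & BP).
assert (CP : forall k, Ckr k P) by (intros; apply Ckr_poly, HP).
destruct (Ckr_bounded P (CP O)) as (M & PM & HM).
assert (Pe : 0 < e ^ 2) by (apply pow_lt, He).
(* The cut-off contributes at most the integral of 2 M^2 exp(-2 K x), which is below M^2 / K = e^2;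
   the polynomial approximation contributes 2 e^2. *)
set (K := M ^ 2 / e ^ 2).
assert (PK : 0 < K) by (apply Rdiv_lt_0_compat; [apply pow_lt, PM | exact Pe]).
exists (fun x => P x * (1 - exp (- K * x))).
assert (Ca : forall k, Ckr k (fun x => P x * (1 - exp (- K * x)))).
{ intros k; specialize (CP k); pose proof (Ckr_exp k (- K)); Ckr_tac. }
split; [apply Ca|]; split; [rewrite Rmult_0_r, exp_0; ring|].
specialize (Ca O); pose proof (Ckr_exp 0 (-2 * K)) as Ce.
apply Rle_trans with (RInt (fun x => 2 * e ^ 2 + 2 * M ^ 2 * exp (-2 * K * x)) 0 1).
- apply RInt_Ckr_le; [Ckr_tac | Ckr_tac |].
  intros x Ix; specialize (BP x Ix); specialize (HM x Ix).
  assert (B1 : (P x - f x) ^ 2 <= e ^ 2).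
  { rewrite <- pow2_abs; apply pow_incr; split; [apply Rabs_pos | exact BP]. }
  assert (B2 : P x ^ 2 <= M ^ 2).
  { rewrite <- pow2_abs; apply pow_incr; split; [apply Rabs_pos | exact HM]. }
  replace (exp (-2 * K * x)) with (exp (- K * x) ^ 2)
    by (simpl; rewrite Rmult_1_r, <- exp_plus; f_equal; ring).
  set (t := exp (- K * x)).
  assert (P x ^ 2 * t ^ 2 <= M ^ 2 * t ^ 2)
    by (apply Rmult_le_compat_r; [apply pow2_ge_0 | exact B2]).
  pose proof (pow2_ge_0 (P x - f x + P x * t)); nra.
- rewrite (FTC _ (fun x => 2 * e ^ 2 * x - M ^ 2 / K * exp (-2 * K * x))).
  + replace (M ^ 2 / K) with (e ^ 2) by (unfold K; field; split; lra).
    rewrite !Rmult_0_r, exp_0; pose proof (exp_pos (-2 * K * 1)); nra.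
  + lra.
  + lra.
  + Ckr_tac.
  + intros x _; auto_derive; [trivial | field; lra].
Qed.

Lemma RInt_sqr_le f e : Ckr 0 f -> (forall x, I01 x -> Rabs (f x) <= e) ->
  RInt (fun x => f x ^ 2) 0 1 <= e ^ 2.
Proof.
intros Cf B; apply Rle_trans with (RInt (fun _ => e ^ 2) 0 1).
- apply RInt_Ckr_le; [Ckr_tac | Ckr_tac |]; intros x Ix.
  rewrite <- pow2_abs; apply pow_incr; split; [apply Rabs_pos | apply B, Ix].
- rewrite RInt_const; change ((1 - 0) * e ^ 2 <= e ^ 2); lra.
Qed.

Section Density.

Context {H1 H2 : Hilbert} {j1 : (R -> C) -> H1} {j2 : (R -> C) -> H2}.
Hypothesis hH1 : is_completion tH1 ip1 H1 j1.
Hypothesis hH2 : is_completion tH2 ip2 H2 j2.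

Lemma pair_norm_lt (x y : prod_Hilbert H1 H2) s t d : 0 < d ->
  norm (hminus (fst x) (fst y)) ^ 2 <= s -> norm (hminus (snd x) (snd y)) ^ 2 <= t ->
  s + t < d ^ 2 -> norm (hminus x y) < d.
Proof.
intros Hd S T Hlt.
assert (E : norm (hminus x y) ^ 2 =
  norm (hminus (fst x) (fst y)) ^ 2 + norm (hminus (snd x) (snd y)) ^ 2)
  by exact (prod_norm_sqr (hminus (fst x) (fst y)) (hminus (snd x) (snd y))).
pose proof (norm_ge_0 (hminus x y)); nra.
Qed.

Lemma prod_dense (x : prod_Hilbert H1 H2) (d : posreal) : exists v1 v2,
  tH1 v1 /\ tH2 v2 /\ norm (hminus ((j1 v1, j2 v2) : prod_Hilbert H1 H2) x) < d.
Proof.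
assert (Hd : 0 < d / 2) by (pose proof (cond_pos d); lra).
destruct (completion_dense _ _ _ _ hH1 (fst x) (mkposreal _ Hd)) as (v1 & T1 & N1).
destruct (completion_dense _ _ _ _ hH2 (snd x) (mkposreal _ Hd)) as (v2 & T2 & N2).
exists v1, v2; split; [exact T1|]; split; [exact T2|]; cbn [pos] in N1, N2.
apply pair_norm_lt with ((d / 2) ^ 2) ((d / 2) ^ 2).
- apply cond_pos.
- apply pow_incr; split; [apply norm_ge_0 | apply Rlt_le, N1].
- apply pow_incr; split; [apply norm_ge_0 | apply Rlt_le, N2].
- pose proof (cond_pos d); nra.
Qed.

(** In the core a must vanish at 0 while b is free there, hence two kinds of approximants. *)
Lemma tL0_dense (x : prod_Hilbert H1 H2) (d : posreal) :
  exists u v, tL0 j1 j2 u v /\ norm (hminus u x) < d.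
Proof.
pose proof (cond_pos d) as Pd.
assert (Hd : 0 < d / 2) by lra.
destruct (prod_dense x (mkposreal _ Hd)) as (v1 & v2 & T1 & T2 & N); cbn [pos] in N.
destruct (tH1_profile v1 T1) as (al1 & al2 & P1), (tH2_profile v2 T2) as (be1 & be2 & P2).
pose proof P1 as (_ & Ca1 & Ca2 & _); pose proof P2 as (_ & Cb1 & Cb2 & _).
(* The squared errors are 3 e^2 for each part of a and e^2 for each part of b: in all 8 e^2 = d^2 /
   8, less than (d / 2)^2. *)
set (e := d / 8); assert (He : 0 < e) by (unfold e; lra).
destruct (L2_approx_vanishing al1 e Ca1 He) as (a1 & (a1' & Da1 & Ca1') & A10 & M1).
destruct (L2_approx_vanishing al2 e Ca2 He) as (a2 & (a2' & Da2 & Ca2') & A20 & M2).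
destruct (weierstrass be1 e Cb1 He) as (b1 & B1 & M3).
destruct (weierstrass be2 e Cb2 He) as (b2 & B2 & M4).
destruct (Ckr_poly 3 b1 B1) as (b1' & Db1 & Cb1'), (Ckr_poly 3 b2 B2) as (b2' & Db2 & Cb2').
pose proof (Ckr_poly 0 b1 B1); pose proof (Ckr_poly 0 b2 B2).
assert (Ckr 2 a1 /\ Ckr 2 a2) as [Xa1 Xa2]
  by (split; [exists a1' | exists a2']; (split; [assumption | apply Ckr_pred; assumption])).
pose proof (Ckr_le 0 2 a1 ltac:(lia) Xa1); pose proof (Ckr_le 0 2 a2 ltac:(lia) Xa2).
destruct (core_realize a1 a1' b1 b1' a2 a2' b2 b2') as (u1 & u2 & Du & Q1 & Q2 & _).
{ apply core_data_of; auto using Ckr_poly. }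
{ apply core_data_of; auto using Ckr_poly. }
exists (j1 u1, j2 u2), (j1 (tL0_1 u1 u2), j2 (tL0_2 u1 u2)).
split; [exists u1, u2; split; [exact Du | split; reflexivity]|].
pose proof (norm_minus_trans ((j1 u1, j2 u2) : prod_Hilbert H1 H2) (j1 v1, j2 v2) x) as T.
cut (norm (hminus ((j1 u1, j2 u2) : prod_Hilbert H1 H2) (j1 v1, j2 v2)) < d / 2); [lra|].
clear T N; apply pair_norm_lt with (6 * e ^ 2) (2 * e ^ 2); cbn [fst snd].
- exact Hd.
- rewrite (norm_minus_profile1 hH1 _ _ _ _ _ _ Q1 P1), RInt_Ckr_plus by Ckr_tac; lra.
- rewrite (norm_minus_profile2 hH2 _ _ _ _ _ _ Q2 P2), RInt_Ckr_plus by Ckr_tac.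
  pose proof (RInt_sqr_le (fun x => b1 x - be1 x) e ltac:(Ckr_tac) M3).
  pose proof (RInt_sqr_le (fun x => b2 x - be2 x) e ltac:(Ckr_tac) M4); lra.
- unfold e; nra.
Qed.

(* In p = a + b and q = a - b the equation decouples into two Euler equations,
   centred at 1 and -1; the first has a polynomial solution, and adding to the
   second a multiple of (1 + x)^(-l-1) achieves a(0) = 0. *)
Lemma core_solve (l : C) A1 A2 B1 B2 : -1 < Re l ->
  is_poly A1 -> is_poly A2 -> is_poly B1 -> is_poly B2 ->
  exists a1 a1' b1 b1' a2 a2' b2 b2',
    (exists f1 g1, core_data f1 g1 a1 a1' b1 b1') /\
    (exists f2 g2, core_data f2 g2 a2 a2' b2 b2') /\
    forall x, -1 < x ->
      Re l * a1 x - Im l * a2 x - (b1' x - a1 x - x * a1' x) = A1 x /\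
      Re l * a2 x + Im l * a1 x - (b2' x - a2 x - x * a2' x) = A2 x /\
      Re l * b1 x - Im l * b2 x - (a1' x - b1 x - x * b1' x) = B1 x /\
      Re l * b2 x + Im l * b1 x - (a2' x - b2 x - x * b2' x) = B2 x.
Proof.
intros Hl HA1 HA2 HB1 HB2.
set (m := Re l + 1); set (n := Im l); assert (Hm : 0 < m) by (unfold m; lra).
destruct (euler_solve 1 _ _ m n (is_poly_plus _ _ HA1 HB1) (is_poly_plus _ _ HA2 HB2) Hm)
  as (p1 & p2 & p1' & p2' & Cp1 & Cp2 & Dp1 & Dp2 & Ep1 & Ep2).
destruct (euler_solve (-1) _ _ m n (is_poly_minus _ _ HA1 HB1) (is_poly_minus _ _ HA2 HB2) Hm)
  as (r1 & r2 & r1' & r2' & Cr1 & Cr2 & Dr1 & Dr2 & Er1 & Er2).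
(* As (1 + x)^(-l-1) equals 1 at 0, the multiple k1 + i k2 makes p + q, and therefore a, vanish at
   0. *)
set (k1 := - (p1 0 + r1 0)); set (k2 := - (p2 0 + r2 0)).
set (E := cpow_re (- m) (- n)); set (S := cpow_im (- m) (- n)).
set (E' := fun x => / (1 + x) * (- m * E x - - n * S x)).
set (S' := fun x => / (1 + x) * (- m * S x + - n * E x)).
assert (DE : forall x, -1 < x -> is_derive E x (E' x))
  by (intros x Hx; apply is_derive_cpow_re, Hx).
assert (DS : forall x, -1 < x -> is_derive S x (S' x))
  by (intros x Hx; apply is_derive_cpow_im, Hx).
assert (EE : forall x, -1 < x -> (1 + x) * E' x = - m * E x + n * S x)
  by (intros x Hx; unfold E'; field; lra).
assert (ES : forall x, -1 < x -> (1 + x) * S' x = - m * S x - n * E x)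
  by (intros x Hx; unfold S'; field; lra).
assert (E0 : E 0 = 1)
  by (unfold E, cpow_re; rewrite Rplus_0_r, ln_1, !Rmult_0_r, exp_0, cos_0; ring).
assert (S0 : S 0 = 0)
  by (unfold S, cpow_im; rewrite Rplus_0_r, ln_1, !Rmult_0_r, sin_0; ring).
assert (CE : Ckr 2 E) by apply Ckr_cpow; assert (CS : Ckr 2 S) by apply Ckr_cpow.
clearbody E S E' S'.
set (q1 := fun x => r1 x + (k1 * E x - k2 * S x)).
set (q2 := fun x => r2 x + (k1 * S x + k2 * E x)).
set (q1' := fun x => r1' x + (k1 * E' x - k2 * S' x)).
set (q2' := fun x => r2' x + (k1 * S' x + k2 * E' x)).
assert (Cq1 : Ckr 2 q1) by (specialize (Cr1 2%nat); unfold q1; Ckr_tac).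
assert (Cq2 : Ckr 2 q2) by (specialize (Cr2 2%nat); unfold q2; Ckr_tac).
assert (Dq1 : forall x, -1 < x -> is_derive q1 x (q1' x)).
{ intros x Hx; apply (is_derive_plus r1); [apply Dr1|].
  apply (is_derive_minus (fun x => k1 * E x) (fun x => k2 * S x));
    apply is_derive_scal; auto. }
assert (Dq2 : forall x, -1 < x -> is_derive q2 x (q2' x)).
{ intros x Hx; apply (is_derive_plus r2); [apply Dr2|].
  apply (is_derive_plus (fun x => k1 * S x) (fun x => k2 * E x));
    apply is_derive_scal; auto. }
assert (Eq1 : forall x, -1 < x -> m * q1 x - n * q2 x + (x + 1) * q1' x = A1 x - B1 x).
{ intros x Hx; specialize (Er1 x); specialize (EE x Hx); specialize (ES x Hx).
  unfold q1, q2, q1'.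
  replace ((x + 1) * (r1' x + (k1 * E' x - k2 * S' x))) with
    ((x - -1) * r1' x + (k1 * ((1 + x) * E' x) - k2 * ((1 + x) * S' x))) by ring.
  rewrite EE, ES; lra. }
assert (Eq2 : forall x, -1 < x -> m * q2 x + n * q1 x + (x + 1) * q2' x = A2 x - B2 x).
{ intros x Hx; specialize (Er2 x); specialize (EE x Hx); specialize (ES x Hx).
  unfold q1, q2, q2'.
  replace ((x + 1) * (r2' x + (k1 * S' x + k2 * E' x))) with
    ((x - -1) * r2' x + (k1 * ((1 + x) * S' x) + k2 * ((1 + x) * E' x))) by ring.
  rewrite EE, ES; lra. }
assert (Q10 : p1 0 + q1 0 = 0) by (unfold q1, k1, k2; rewrite E0, S0; ring).
assert (Q20 : p2 0 + q2 0 = 0) by (unfold q2, k1, k2; rewrite E0, S0; ring).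
specialize (Cp1 2%nat); specialize (Cp2 2%nat).
clearbody q1 q2 q1' q2'.
(* Back to a = (p + q) / 2 and b = (p - q) / 2, written in the shape of [is_derive_lin]. *)
exists (fun x => 1 / 2 * p1 x + 1 / 2 * q1 x), (fun x => 1 / 2 * p1' x + 1 / 2 * q1' x),
  (fun x => 1 / 2 * p1 x + - (1 / 2) * q1 x), (fun x => 1 / 2 * p1' x + - (1 / 2) * q1' x),
  (fun x => 1 / 2 * p2 x + 1 / 2 * q2 x), (fun x => 1 / 2 * p2' x + 1 / 2 * q2' x),
  (fun x => 1 / 2 * p2 x + - (1 / 2) * q2 x), (fun x => 1 / 2 * p2' x + - (1 / 2) * q2' x).
split; [|split].
- apply core_data_of; [lra | Ckr_tac | Ckr_tac | |];
    intros x Hx; apply is_derive_lin; auto.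
- apply core_data_of; [lra | Ckr_tac | Ckr_tac | |];
    intros x Hx; apply is_derive_lin; auto.
- intros x Hx; specialize (Ep1 x); specialize (Ep2 x).
  specialize (Eq1 x Hx); specialize (Eq2 x Hx); fold n.
  replace (Re l) with (m - 1) by (unfold m; ring).
  repeat split; lra.
Qed.

(** The equation is solved exactly for polynomial profiles, so only the error of approximating f by
    such data remains. *)
Lemma tL0_range_dense (l : C) (f : prod_Hilbert H1 H2) (d : posreal) : -1 < Re l ->
  exists u v, tL0 j1 j2 u v /\ norm (hminus (hminus (hscal l u) v) f) < d.
Proof.
intros Hl; pose proof (cond_pos d) as Pd.
assert (Hd : 0 < d / 2) by lra.
destruct (prod_dense f (mkposreal _ Hd)) as (v1 & v2 & T1 & T2 & N); cbn [pos] in N.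
destruct (tH1_profile v1 T1) as (al1 & al2 & P1), (tH2_profile v2 T2) as (be1 & be2 & P2).
pose proof P1 as (_ & Ca1 & Ca2 & _); pose proof P2 as (_ & Cb1 & Cb2 & _).
set (e := d / 8); assert (He : 0 < e) by (unfold e; lra).
destruct (weierstrass al1 e Ca1 He) as (A1 & PA1 & M1).
destruct (weierstrass al2 e Ca2 He) as (A2 & PA2 & M2).
destruct (weierstrass be1 e Cb1 He) as (B1 & PB1 & M3).
destruct (weierstrass be2 e Cb2 He) as (B2 & PB2 & M4).
destruct (core_solve l A1 A2 B1 B2 Hl PA1 PA2 PB1 PB2)
  as (a1 & a1' & b1 & b1' & a2 & a2' & b2 & b2' & K1 & K2 & Eqs).
destruct (core_realize _ _ _ _ _ _ _ _ K1 K2) as (u1 & u2 & Du & Q1 & Q2 & Q3 & Q4).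
exists (j1 u1, j2 u2), (j1 (tL0_1 u1 u2), j2 (tL0_2 u1 u2)).
split; [exists u1, u2; split; [exact Du | split; reflexivity]|].
set (z := RtoC (Ropp 1)).
set (w1 := fun r => (l * u1 r + z * tL0_1 u1 u2 r)%C).
set (w2 := fun r => (l * u2 r + z * tL0_2 u1 u2 r)%C).
pose proof (profile1_plus _ _ _ _ _ _ (profile1_scal l _ _ _ Q1) (profile1_scal z _ _ _ Q3)) as R1.
pose proof (profile2_plus _ _ _ _ _ _ (profile2_scal l _ _ _ Q2) (profile2_scal z _ _ _ Q4)) as R2.
fold w1 in R1; fold w2 in R2.
(* The representative of a profile may be exchanged for another one that agrees on [0,1]; by [Eqs]
   the polynomial data do. *)
assert (S1 : profile1 w1 A1 A2).
{ destruct R1 as (T & _ & _ & E); split; [exact T|].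
  split; [apply Ckr_poly, PA1|]; split; [apply Ckr_poly, PA2|].
  intros x Ix; destruct (Eqs x (I01_gt x Ix)) as (E1 & E2 & _).
  rewrite E by exact Ix; rewrite <- E1, <- E2; unfold z.
  apply injective_projections; simpl; ring. }
assert (S2 : profile2 w2 B1 B2).
{ destruct R2 as (T & _ & _ & E); split; [exact T|].
  split; [apply Ckr_poly, PB1|]; split; [apply Ckr_poly, PB2|].
  intros x Ix; destruct (Eqs x (I01_gt x Ix)) as (_ & _ & E1 & E2).
  rewrite E by exact Ix; rewrite <- E1, <- E2; unfold z.
  apply injective_projections; simpl; ring. }
assert (W : hminus (hscal l ((j1 u1, j2 u2) : prod_Hilbert H1 H2))
  (j1 (tL0_1 u1 u2), j2 (tL0_2 u1 u2)) = (j1 w1, j2 w2)).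
{ apply injective_projections.
  - change (hminus (hscal l (j1 u1)) (j1 (tL0_1 u1 u2)) = j1 w1); unfold w1.
    rewrite (completion_plus _ _ _ _ hH1)
      by (exact (proj1 (profile1_scal _ _ _ _ Q1)) || exact (proj1 (profile1_scal _ _ _ _ Q3))).
    rewrite !(completion_scal _ _ _ _ hH1) by (exact (proj1 Q1) || exact (proj1 Q3)).
    unfold z; rewrite RtoC_opp; hring.
  - change (hminus (hscal l (j2 u2)) (j2 (tL0_2 u1 u2)) = j2 w2); unfold w2.
    rewrite (completion_plus _ _ _ _ hH2)
      by (exact (proj1 (profile2_scal _ _ _ _ Q2)) || exact (proj1 (profile2_scal _ _ _ _ Q4))).
    rewrite !(completion_scal _ _ _ _ hH2) by (exact (proj1 Q2) || exact (proj1 Q4)).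
    unfold z; rewrite RtoC_opp; hring. }
rewrite W.
pose proof (norm_minus_trans ((j1 w1, j2 w2) : prod_Hilbert H1 H2) (j1 v1, j2 v2) f) as T.
cut (norm (hminus ((j1 w1, j2 w2) : prod_Hilbert H1 H2) (j1 v1, j2 v2)) < d / 2); [lra|].
pose proof (Ckr_poly 0 _ PA1); pose proof (Ckr_poly 0 _ PA2).
pose proof (Ckr_poly 0 _ PB1); pose proof (Ckr_poly 0 _ PB2).
clear T N; apply pair_norm_lt with (2 * e ^ 2) (2 * e ^ 2); cbn [fst snd].
- exact Hd.
- rewrite (norm_minus_profile1 hH1 _ _ _ _ _ _ S1 P1), RInt_Ckr_plus by Ckr_tac.
  pose proof (RInt_sqr_le (fun x => A1 x - al1 x) e ltac:(Ckr_tac) M1).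
  pose proof (RInt_sqr_le (fun x => A2 x - al2 x) e ltac:(Ckr_tac) M2); lra.
- rewrite (norm_minus_profile2 hH2 _ _ _ _ _ _ S2 P2), RInt_Ckr_plus by Ckr_tac.
  pose proof (RInt_sqr_le (fun x => B1 x - be1 x) e ltac:(Ckr_tac) M3).
  pose proof (RInt_sqr_le (fun x => B2 x - be2 x) e ltac:(Ckr_tac) M4); lra.
- unfold e; nra.
Qed.

End Density.

Theorem lemma4p23
  (H1 H2 : Hilbert) (j1 : (R -> C) -> H1) (j2 : (R -> C) -> H2)
  (hH1 : is_completion tH1 ip1 H1 j1) (hH2 : is_completion tH2 ip2 H2 j2)
  (L' : prod_Hilbert H1 H2 -> prod_Hilbert H1 H2) (hL' : is_L' j1 j2 L')
  (eps : R) (heps : 0 < eps) :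
  (exists r K : R, 0 < r /\ 0 < K /\
     forall l : C, - (1 / 2) + eps <= Re l -> r <= Cmod l ->
       resolvent_set (L j1 j2 L') l /\
       forall RL, is_resolvent (L j1 j2 L') l RL -> Rbar_le (op_norm RL) K) /\
  (exists s : R, 0 < s /\
     forall l : C, - (1 / 2) + eps <= Re l -> s <= Rabs (Im l) ->
       ~ spectrum (L j1 j2 L') l).
Proof.
(* With t = 1 / eps, |l| >= r gives |l|^2 >= 324^2 (1 + t^2), and |u| <= t F. As 324^2 = 104976
   exceeds 4 * 26112, [tL'_small] yields |L' u| <= F / 2. *)
set (r := 324 * (1 + / eps)).
assert (Pi : 0 < / eps) by (apply Rinv_0_lt_compat, heps).
assert (Main : forall l : C, - (1 / 2) + eps <= Re l -> r <= Cmod l ->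
  resolvent_set (L j1 j2 L') l /\
  forall RL, is_resolvent (L j1 j2 L') l RL -> Rbar_le (op_norm RL) (2 / eps)).
{ intros l Hl Hr.
  assert (small : forall u v, tL0 j1 j2 u v ->
    norm (L' u) <= 1 / 2 * norm (hminus (hscal l u) v)).
  { intros u v Auv.
    pose proof (tL'_small hH1 hH2 L' hL' l u v Auv) as B.
    pose proof (dissipative_lower_bound (tL0 j1 j2) (tL0_dissipative hH1 hH2) l u v Auv) as LB.
    set (F := norm (hminus (hscal l u) v)) in *.
    assert (F0 : 0 <= F) by apply norm_ge_0.
    pose proof (norm_ge_0 u) as U0; pose proof (norm_ge_0 (L' u)) as V0.
    assert (U1 : norm u <= / eps * F).
    { apply Rmult_le_reg_l with eps; [exact heps|].
      rewrite <- Rmult_assoc, Rinv_r, Rmult_1_l by lra.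
      eapply Rle_trans; [|exact LB]; apply Rmult_le_compat_r; lra. }
    assert (U2 : norm u ^ 2 <= / eps ^ 2 * F ^ 2).
    { rewrite <- pow_inv, <- Rpow_mult_distr; apply pow_incr; lra. }
    assert (R2 : 104976 * (1 + / eps ^ 2) <= Cmod l ^ 2).
    { apply Rle_trans with (r ^ 2); [|apply pow_incr; unfold r in *; lra].
      unfold r; rewrite <- pow_inv; nra. }
    rewrite <- pow_inv in *; set (t := / eps) in *.
    assert (V2 : 104976 * (1 + t ^ 2) * norm (L' u) ^ 2 <= 26112 * ((1 + t ^ 2) * F ^ 2)).
    { eapply Rle_trans; [apply Rmult_le_compat_r; [apply pow2_ge_0 | exact R2]|]; lra. }
    assert (V3 : norm (L' u) ^ 2 <= (1 / 2 * F) ^ 2).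
    { apply Rmult_le_reg_l with (1 + t ^ 2); [nra|].
      pose proof (pow2_ge_0 F); pose proof (pow2_ge_0 t); nra. }
    apply Rnot_lt_le; intros Hlt; nra. }
  assert (rd : forall (f : prod_Hilbert H1 H2) (d : posreal),
    exists u v, tL0 j1 j2 u v /\ norm (hminus (hminus (hscal l u) v) f) < d)
    by (intros f d; apply (tL0_range_dense hH1 hH2); lra).
  split.
  - exact (perturbed_resolvent_set _ _ (tL0_plus hH1 hH2) (tL0_scal hH1 hH2)
      (tL0_dense hH1 hH2) (tL0_dissipative hH1 hH2) (proj1 hL') eps l heps Hl rd small).
  - intros RL HR.
    exact (perturbed_resolvent_norm _ _
      (tL0_dissipative hH1 hH2) (proj1 hL') eps l heps Hl small RL HR). }
assert (Pr : 0 < r) by (unfold r; lra).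
split.
- exists r, (2 / eps); split; [exact Pr|]; split; [apply Rdiv_lt_0_compat; lra | exact Main].
- exists r; split; [exact Pr|]; intros l Hl Hi Sp; apply Sp, Main; [exact Hl|].
  eapply Rle_trans; [exact Hi|].
  destruct l as [x y]; unfold Cmod; simpl; rewrite <- sqrt_Rsqr_abs.
  apply sqrt_le_1_alt; unfold Rsqr; nra.
Qed.
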